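(* Let $G$ be a countable discrete group and let $\omega\in\beta G$. If $s_\omega$ has a unique extension to a state on $B(\ell^2(G))$, then $$VN(G)\subseteq\mathcal{R}(\psi_\omega)\subseteq\mathcal{F}(\mathcal{A}_\omega).$$
   Context: $G$ is a countable discrete group, $\{e_g\}_{g\in G}$ is the canonical orthonormal basis of $\ell^2(G)$, and $U_g=\lambda(g)$ is the left regular representation, $U_g e_h = e_{gh}$. $\mathcal{D} = \{M_f : f \in \ell^\infty(G)\}\subseteq B(\ell^2(G))$ is the algebra of diagonal (multiplication) operators, identified with $\ell^\infty(G) \equiv C(\beta G)$, where $\beta G$ is the Stone-Cech compactification of $G$; the continuous extension of $f$ to $\beta G$ is again denoted $f$. Left multiplication $g_1\mapsto g g_1$ extends to a homeomorphism of $\beta G$, written $\omega\mapsto g\cdot\omega$, giving an action of $G$ on $\beta G$. For $\omega\in\beta G$, $s_\omega:\mathcal{D}\to\mathbb{C}$ is the pure state $s_\omega(M_f)=f(\omega)$, and $\pi_\omega:\mathcal{D}\to\mathcal{D}$ is the $*$-homomorphism $\pi_\omega(M_f)=M_{h}$ with $h(g)=f(g\cdot\omega)$. $\mathcal{D}\times_r G$ denotes the C*-subalgebra of $B(\ell^2(G))$ generated by $\mathcal{D}$ and $\{U_g:g\in G\}$, and $\pi_\omega\times\lambda:\mathcal{D}\times_r G\to B(\ell^2(G))$ is the $*$-homomorphism with $\pi_\omega\times\lambda(\sum_n M_{f_n}U_{g_n})=\sum_n\pi_\omega(M_{f_n})U_{g_n}$ for finite (or norm convergent) sums. Put $\mathcal{A}_\omega=\pi_\omega\times\lambda(\mathcal{D}\times_r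 G)$, and let $VN(G)$ be the von Neumann algebra generated by $\{U_g:g\in G\}$. Let $E_0:B(\ell^2(G))\to\mathcal{D}$ be the canonical projection (conditional expectation) onto the diagonal. The regular completely positive extension $\psi_\omega:B(\ell^2(G))\to B(\ell^2(G))$ of $\pi_\omega\times\lambda$ is the completely positive map determined by $\langle\psi_\omega(X)e_h,e_g\rangle=s_\omega(E_0(U_{g^{-1}}XU_h))$ for all $g,h\in G$; $\mathcal{R}(\psi_\omega)$ denotes its range. For a unital C*-subalgebra $\mathcal{A}\subseteq B(\mathcal{H})$, $\mathcal{F}(\mathcal{A})$ denotes the set of elements of $B(\mathcal{H})$ that are fixed by every completely positive map $B(\mathcal{H})\to B(\mathcal{H})$ that fixes $\mathcal{A}$ elementwise. (The set $\mathcal{F}(\mathcal{A})$ is contained in every copy of the injective envelope of $\mathcal{A}$ in $B(\mathcal{H})$.) *)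

(* Defs.v *)
From HB Require Import structures.
From mathcomp Require Import all_boot all_order all_algebra.
From mathcomp Require Import all_classical all_reals all_analysis.
From mathcomp Require Import complex summability.
From mathcomp Require Import finmap ring.

Set Implicit Arguments.
Unset Strict Implicit.
Unset Printing Implicit Defensive.

Import Order.TTheory GRing.Theory Num.Theory.
Import numFieldNormedType.Exports.

Local Open Scope classical_set_scope.
Local Open Scope ring_scope.

Notation normc := ComplexField.Normc.normc.
Local Notation "x %:C" := (real_complex _ x) : ring_scope.

(* The topology of R[i] is the one given by its R[i]-valued modulus. *)
HB.instance Definition _ (R : rcfType) := NormedModule.copy R[i] (R[i])^o.

Section L2.
Context {R : realType} {I : choiceType}.
Implicit Types (x y : I -> R[i]) (F : {fset I}) (a b c M : R).

Definition sqnorm x : \bar R := \esum_(i in [set: I]) (normc (x i) ^+ 2)%:E.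

Local Definition fsum x F : R := \sum_(i <- F) normc (x i) ^+ 2.

Lemma normc_ge0 (z : R[i]) : 0 <= normc z.
Proof. by case: z => u v; exact: sqrtr_ge0. Qed.

Local Lemma fsum_ge0 x F : 0 <= fsum x F.
Proof. by apply: sumr_ge0 => i _; rewrite sqr_ge0. Qed.

Lemma sqnorm_leP x M :
  (sqnorm x <= M%:E)%E <-> (forall F, \sum_(i <- F) normc (x i) ^+ 2 <= M).
Proof.
split=> [xM F|xM].
  rewrite -lee_fin (le_trans _ xM)//; apply: ereal_sup_ubound => /=.
  exists [set` F]; first by split=> //; exact: finite_fset.
  by rewrite fsbig_finite ?set_fsetK ?sumEFin//; exact: finite_fset.
apply: ge_ereal_sup => _ [A [finA _] <-].
by rewrite fsbig_finite// sumEFin lee_fin; exact: xM.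
Qed.

Lemma sqnorm_ge0 x : (0 <= sqnorm x)%E.
Proof. by apply: esum_ge0 => i _; rewrite lee_fin sqr_ge0. Qed.

Lemma sqnorm_fin x : (sqnorm x < +oo)%E <-> exists M, (sqnorm x <= M%:E)%E.
Proof.
split=> [xoo|[M xM]]; last by rewrite (le_lt_trans xM)// ltry.
by exists (fine (sqnorm x)); rewrite fineK// ge0_fin_numE// sqnorm_ge0.
Qed.

Definition l2norm x : R := Num.sqrt (fine (sqnorm x)).

Lemma l2norm_ge0 x : 0 <= l2norm x. Proof. exact: sqrtr_ge0. Qed.

Lemma l2norm_leP x c : 0 <= c ->
  ((sqnorm x < +oo)%E /\ l2norm x <= c) <->
  (forall F, \sum_(i <- F) normc (x i) ^+ 2 <= c ^+ 2).
Proof.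
move=> c0; rewrite -sqnorm_leP; have x0 := sqnorm_ge0 x; split.
  move=> [xoo xc]; have xf : sqnorm x \is a fin_num by rewrite ge0_fin_numE.
  rewrite -(fineK xf) lee_fin -(sqr_sqrtr (fine_ge0 x0)).
  by rewrite lerXn2r// nnegrE ?sqrtr_ge0.
move=> xc; have xoo : (sqnorm x < +oo)%E by rewrite (le_lt_trans xc)// ltry.
split=> //; rewrite /l2norm -(ger0_norm c0) -sqrtr_sqr ler_wsqrtr//.
by rewrite -lee_fin fineK// ge0_fin_numE.
Qed.

Local Lemma fsum_le x y a b F : 0 <= a -> 0 <= b ->
  fsum x F <= a ^+ 2 -> fsum y F <= b ^+ 2 ->
  \sum_(i <- F) normc (x i + y i) ^+ 2 <= (a + b) ^+ 2.
Proof.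
have zeroP z : fsum z F <= 0 -> forall i, i \in F -> normc (z i) = 0.
  move=> z0 i iF; have /eqP : fsum z F = 0 by apply/le_anti; rewrite z0 fsum_ge0.
  rewrite psumr_eq0; last by move=> j _; rewrite sqr_ge0.
  by move=> /allP /(_ _ iF); rewrite sqrf_eq0 => /eqP.
rewrite le_eqVlt => /predU1P[<-|a0] b0 xa yb.
  rewrite add0r (le_trans _ yb)//; rewrite expr0n/= in xa.
  rewrite /fsum big_seq [leRHS]big_seq; apply: ler_sum => i iF.
  rewrite lerXn2r ?nnegrE ?normc_ge0// (le_trans (le_normcD _ _))//.
  by rewrite (zeroP _ xa)// add0r.
move: b0; rewrite le_eqVlt => /predU1P[b0|b0].
  rewrite -b0 addr0 (le_trans _ xa)//; rewrite -b0 expr0n/= in yb.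
  rewrite /fsum big_seq [leRHS]big_seq; apply: ler_sum => i iF.
  rewrite lerXn2r ?nnegrE ?normc_ge0// (le_trans (le_normcD _ _))//.
  by rewrite (zeroP _ yb)// addr0.
have -> : (a + b) ^+ 2 = (1 + b / a) * a ^+ 2 + (1 + a / b) * b ^+ 2.
  by field; rewrite !gt_eqF.
apply: le_trans (_ : (1 + b / a) * fsum x F + (1 + a / b) * fsum y F <= _).
  rewrite /fsum !mulr_sumr -big_split/=; apply: ler_sum => i _.
  apply: le_trans (_ : (normc (x i) + normc (y i)) ^+ 2 <= _).
    by rewrite lerXn2r ?nnegrE ?addr_ge0 ?normc_ge0// le_normcD.
  set u := normc (x i); set v := normc (y i).
  rewrite -subr_ge0.
  have -> : (1 + b / a) * u ^+ 2 + (1 + a / b) * v ^+ 2 - (u + v) ^+ 2 =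
            (b * u - a * v) ^+ 2 / (a * b) by field; rewrite !gt_eqF.
  by rewrite divr_ge0 ?sqr_ge0 ?mulr_ge0 ?ltW.
by rewrite lerD// ler_wpM2l// addr_ge0// divr_ge0 ?ltW.
Qed.

Lemma l2normD x y : (sqnorm x < +oo)%E -> (sqnorm y < +oo)%E ->
  (sqnorm (x + y)%R < +oo)%E /\ l2norm (x + y) <= l2norm x + l2norm y.
Proof.
move=> xoo yoo; apply/l2norm_leP; first by rewrite addr_ge0 ?l2norm_ge0.
have xF := (l2norm_leP x (l2norm_ge0 x)).1 (conj xoo (lexx _)).
have yF := (l2norm_leP y (l2norm_ge0 y)).1 (conj yoo (lexx _)).
by move=> F; apply: fsum_le; rewrite ?l2norm_ge0//; [exact: xF|exact: yF].
Qed.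

Lemma l2normZ_le (k : R[i]) x : (sqnorm x < +oo)%E ->
  (sqnorm (k *: x)%R < +oo)%E /\ l2norm (k *: x) <= normc k * l2norm x.
Proof.
move=> xoo; apply/l2norm_leP; first by rewrite mulr_ge0 ?normc_ge0 ?l2norm_ge0.
have xF := (l2norm_leP x (l2norm_ge0 x)).1 (conj xoo (lexx _)).
move=> F; rewrite exprMn (le_trans _ (ler_wpM2l (sqr_ge0 _) (xF F)))//.
rewrite mulr_sumr; apply: ler_sum => i _.
by rewrite ComplexField.Normc.normcM exprMn.
Qed.

Lemma sqnorm0 : sqnorm 0 = 0%E.
Proof.
by apply: esum1 => i _; rewrite ComplexField.Normc.normc0 expr0n.
Qed.

Lemma l2norm0 : l2norm 0 = 0.
Proof. by rewrite /l2norm sqnorm0 sqrtr0. Qed.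

Lemma l2norm_eq0 x : (sqnorm x < +oo)%E -> l2norm x = 0 -> x = 0.
Proof.
move=> xoo x0; apply/funext => i.
have xle : l2norm x <= 0 by rewrite x0.
have := (l2norm_leP x (lexx 0)).1 (conj xoo xle) [fset i]%fset.
rewrite big_seq_fset1 expr0n/= => xi0; apply: ComplexField.Normc.eq0_normc.
by apply/eqP; rewrite -sqrf_eq0 eq_le xi0 sqr_ge0.
Qed.

Definition l2_pred : {pred I -> R[i]} := fun x => (sqnorm x < +oo)%E.

Lemma l2_submod_closed : submod_closed l2_pred.
Proof.
split=> [|k x y]; first by rewrite unfold_in sqnorm0 ltry.
rewrite !unfold_in => xoo yoo.
exact: (l2normD (l2normZ_le k xoo).1 yoo).1.
Qed.

HB.instance Definition _ :=
  GRing.isSubmodClosed.Build R[i] (I -> R[i]) l2_pred l2_submod_closed.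

End L2.

Record l2 (R : realType) (I : choiceType) := L2 {
  l2val :> I -> R[i];
  l2valP : l2val \in l2_pred }.
Arguments L2 {R I} l2val l2valP.

Section L2Space.
Context {R : realType} {I : choiceType}.
Local Notation H := (l2 R I).
Implicit Types x y : H.

HB.instance Definition _ := [isSub for @l2val R I].
HB.instance Definition _ := [Choice of H by <:].
HB.instance Definition _ := [SubChoice_isSubLmodule of H by <:].

Lemma l2_normD x y :
  (l2norm (x + y : H))%:C <= (l2norm x)%:C + (l2norm y)%:C :> R[i].
Proof.
by rewrite -rmorphD lecR; exact: (l2normD (l2valP x) (l2valP y)).2.
Qed.

Lemma l2_normZ (k : R[i]) x :
  (l2norm (k *: x : H))%:C = `|k| * (l2norm x)%:C :> R[i].
Proof.
have -> : `|k| = (normc k)%:C by [].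
rewrite -rmorphM; congr _%:C; apply/le_anti.
rewrite (l2normZ_le k (l2valP x)).2/=.
have [->|k0] := eqVneq k 0.
  by rewrite ComplexField.Normc.normc0 mul0r l2norm_ge0.
have nk0 : 0 < normc k.
  rewrite lt_def normc_ge0 andbT; apply: contra k0 => /eqP.
  by move=> /ComplexField.Normc.eq0_normc ->.
rewrite mulrC -ler_pdivlMr// mulrC -ComplexField.Normc.normcV.
have := (l2normZ_le k^-1 (l2valP (k *: x))).2.
suff -> : k^-1 *: l2val (k *: x) = l2val x by [].
by apply/funext => i; exact: (mulKf k0 (x i)).
Qed.

Lemma l2_norm_eq0 x : (l2norm x)%:C = 0 :> R[i] -> x = 0.
Proof.
move=> /complexI x0; apply: val_inj; exact: l2norm_eq0 (l2valP x) x0.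
Qed.

HB.instance Definition _ :=
  Lmodule_isNormed.Build R[i] H l2_normD l2_normZ l2_norm_eq0.

Lemma l2normE x : `|x| = (l2norm x)%:C. Proof. by []. Qed.

(* The sum is the unconditional one (limit over the finite subsets of I);
   inner is linear in its first argument, conjugate-linear in the second. *)
Definition inner x y : R[i] := summability.sum (fun i => x i * (y i)^*).

Lemma basis_l2_le1 (i : I) : (fun j => (j == i)%:R : R[i]) \in l2_pred /\
  l2norm (fun j => (j == i)%:R : R[i]) <= 1.
Proof.
have h (F : {fset I}) : \sum_(j <- F) normc ((j == i)%:R : R[i]) ^+ 2 <= (1 : R) ^+ 2.
  rewrite expr1n; have [iF|iF] := boolP (i \in F).
    rewrite (big_fsetD1 i)//= eqxx ComplexField.Normc.normc1 expr1n.
    rewrite big_seq big1 ?addr0// => j; rewrite !inE => /andP[/negPf -> _].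
    by rewrite ComplexField.Normc.normc0 expr0n.
  rewrite big_seq big1 ?ler01// => j jF.
  have /negPf -> : j != i by apply: contraNneq iF => <-.
  by rewrite ComplexField.Normc.normc0 expr0n.
exact: ((l2norm_leP _ ler01).2 h).
Qed.

Definition basis (i : I) : H := L2 _ (basis_l2_le1 i).1.

Lemma l2norm_basis i : l2norm (basis i) <= 1.
Proof. exact: (basis_l2_le1 i).2. Qed.

Lemma normc_coord x i : normc (x i) <= l2norm x.
Proof.
have := (l2norm_leP x (l2norm_ge0 x)).1 (conj (l2valP x) (lexx _)) [fset i]%fset.
by rewrite big_seq_fset1 ler_pXn2r// nnegrE ?normc_ge0 ?l2norm_ge0.
Qed.

Lemma inner_basis x i : inner x (basis i) = x i.
Proof.
rewrite /inner /summability.sum; apply: lim_near_cst.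
  exact: norm_hausdorff.
  exact: totally_filter.
exists [fset i]%fset => //= A /=; rewrite fsub1set => iA.
rewrite /partial_sum (bigD1 [` iA]%fset)//= eqxx conjC1 mulr1.
rewrite big1 ?addr0// => j ji.
have /negPf -> : fsval j != i by apply: contra ji => /eqP ji; apply/eqP/val_inj.
by rewrite conjC0 mulr0.
Qed.

End L2Space.

Section Operators.
Context {R : realType} {I : choiceType}.
Local Notation H := (l2 R I).

Definition bounded_linear : {pred H -> H} := fun T =>
  `[< linear T /\ exists c : R, forall x, l2norm (T x) <= c * l2norm x >].

Lemma bounded_linear_submod_closed : submod_closed bounded_linear.
Proof.
split=> [|k S T]; rewrite !unfold_in.
  apply/asboolP; split=> [a x y|]; first by rewrite /= scaler0 addr0.
  by exists 0 => x; rewrite mul0r (l2norm0 : l2norm ((0 : H -> H) x) = 0).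
move=> /asboolP[linS [c cS]] /asboolP[linT [d dT]]; apply/asboolP; split.
  move=> a x y; rewrite /= !fctE linS linT.
  by rewrite !scalerDr !scalerA (mulrC k) addrACA.
exists (normc k * c + d) => x.
have kS := l2normZ_le k (l2valP (S x)).
apply: le_trans (l2normD kS.1 (l2valP (T x))).2 _.
rewrite mulrDl lerD// (le_trans kS.2)// -mulrA.
by rewrite ler_wpM2l ?normc_ge0.
Qed.

HB.instance Definition _ := GRing.isSubmodClosed.Build R[i] (H -> H)
  bounded_linear bounded_linear_submod_closed.

End Operators.

Record bop (R : realType) (I : choiceType) := Bop {
  bopval :> l2 R I -> l2 R I;
  bopP : bopval \in bounded_linear }.
Arguments Bop {R I} bopval bopP.

Section OperatorSpace.
Context {R : realType} {I : choiceType}.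
Local Notation H := (l2 R I).
Local Notation B := (bop R I).
Implicit Types S T : B.

HB.instance Definition _ := [isSub for @bopval R I].
HB.instance Definition _ := [Choice of B by <:].
HB.instance Definition _ := [SubChoice_isSubLmodule of B by <:].

Lemma bop_linear T : linear T. Proof. by have /asboolP[] := bopP T. Qed.

HB.instance Definition _ T := GRing.isLinear.Build R[i] H H _ T (bop_linear T).

Lemma bop_bounded T : exists c : R, forall x, l2norm (T x) <= c * l2norm x.
Proof. by have /asboolP[] := bopP T. Qed.

(* B(l2 I): norms are real-valued here and embedded in R[i] by %:C, as required
   by the normed module structure over R[i]. *)
Definition opbound T : set R :=
  [set c | 0 <= c /\ forall x, l2norm (T x) <= c * l2norm x].

Definition opnorm T : R := inf (opbound T).

Local Lemma opbound0 T : opbound T !=set0.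
Proof.
have [c cT] := bop_bounded T; exists `|c|; split=> // x.
by rewrite (le_trans (cT x))// ler_wpM2r ?l2norm_ge0// ler_norm.
Qed.

Local Lemma opbound_lb T : has_lbound (opbound T).
Proof. by exists 0 => c []. Qed.

Lemma opnorm_ge0 T : 0 <= opnorm T.
Proof. by apply: lb_le_inf; [exact: opbound0|move=> c []]. Qed.

Lemma opnorm_le T c : 0 <= c ->
  (forall x, l2norm (T x) <= c * l2norm x) -> opnorm T <= c.
Proof. by move=> c0 cT; apply: ge_inf => //; exact: opbound_lb. Qed.

Lemma l2norm_bop T x : l2norm (T x) <= opnorm T * l2norm x.
Proof.
have [x0|x0] := eqVneq (l2norm x) 0.
  have -> : x = 0 by apply: l2_norm_eq0; rewrite x0.
  by rewrite linear0 (l2norm0 : l2norm (0 : H) = 0) mulr0.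
have nx : 0 < l2norm x by rewrite lt_def x0 l2norm_ge0.
rewrite -ler_pdivrMr//; apply: lb_le_inf; first exact: opbound0.
by move=> c [_ cT]; rewrite ler_pdivrMr.
Qed.

Lemma opnormD S T :
  (opnorm (S + T))%:C <= (opnorm S)%:C + (opnorm T)%:C :> R[i].
Proof.
rewrite -rmorphD lecR; apply: opnorm_le; first by rewrite addr_ge0 ?opnorm_ge0.
move=> x; rewrite mulrDl.
apply: le_trans (l2normD (l2valP (S x)) (l2valP (T x))).2 _.
by rewrite lerD// l2norm_bop.
Qed.

Local Lemma opnormZ_le (k : R[i]) T : opnorm (k *: T) <= normc k * opnorm T.
Proof.
apply: opnorm_le; first by rewrite mulr_ge0 ?normc_ge0 ?opnorm_ge0.
move=> x; apply: le_trans (l2normZ_le k (l2valP (T x))).2 _.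
by rewrite -mulrA ler_wpM2l ?normc_ge0 ?l2norm_bop.
Qed.

Lemma opnormZ (k : R[i]) T : (opnorm (k *: T))%:C = `|k| * (opnorm T)%:C :> R[i].
Proof.
have -> : `|k| = (normc k)%:C by [].
rewrite -rmorphM; congr _%:C; apply/le_anti; rewrite opnormZ_le/=.
have [->|k0] := eqVneq k 0.
  by rewrite ComplexField.Normc.normc0 mul0r opnorm_ge0.
have nk0 : 0 < normc k.
  rewrite lt_def normc_ge0 andbT; apply: contra k0 => /eqP.
  by move=> /ComplexField.Normc.eq0_normc ->.
rewrite mulrC -ler_pdivlMr// mulrC -ComplexField.Normc.normcV.
by have := opnormZ_le k^-1 (k *: T); rewrite scalerA mulVf// scale1r.
Qed.

Lemma opnorm_eq0 T : (opnorm T)%:C = 0 :> R[i] -> T = 0.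
Proof.
move=> /complexI T0; apply/val_inj/funext => x /=.
apply: l2_norm_eq0; congr _%:C; apply/le_anti.
by rewrite l2norm_ge0 andbT (le_trans (l2norm_bop T x))// T0 mul0r.
Qed.

HB.instance Definition _ :=
  Lmodule_isNormed.Build R[i] B opnormD opnormZ opnorm_eq0.

Lemma bop_one_subproof : (idfun : H -> H) \in bounded_linear.
Proof.
by rewrite unfold_in; apply/asboolP; split=> //; exists 1 => x; rewrite mul1r.
Qed.

Lemma bop_mul_subproof S T : (S \o T : H -> H) \in bounded_linear.
Proof.
rewrite unfold_in; apply/asboolP; split=> [a x y|]; first by rewrite /= !linearP.
exists (opnorm S * opnorm T) => x /=.
rewrite (le_trans (l2norm_bop S _))// -mulrA.
by rewrite ler_wpM2l ?opnorm_ge0 ?l2norm_bop.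
Qed.

Definition bop_one : B := Bop _ bop_one_subproof.
Definition bop_mul S T : B := Bop _ (bop_mul_subproof S T).

Local Lemma bop_mulA : associative bop_mul.
Proof. by move=> S T V; apply: val_inj. Qed.
Local Lemma bop_mul1 : left_id bop_one bop_mul.
Proof. by move=> S; apply: val_inj. Qed.
Local Lemma bop_1mul : right_id bop_one bop_mul.
Proof. by move=> S; apply: val_inj. Qed.
Local Lemma bop_mulDl : left_distributive bop_mul +%R.
Proof. by move=> S T V; apply: val_inj. Qed.
Local Lemma bop_mulDr : right_distributive bop_mul +%R.
Proof.
by move=> S T V; apply/val_inj/funext => x; exact: (linearD S).
Qed.

HB.instance Definition _ := GRing.Zmodule_isPzRing.Build B
  bop_mulA bop_mul1 bop_1mul bop_mulDl bop_mulDr.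

(* S = T^*; the product of B is composition of operators. *)
Definition adjoint_of T S := forall x y, inner (T x) y = inner x (S y).

Definition positive T := forall x, 0 <= inner (T x) x.

Definition state (phi : B -> R[i]) :=
  [/\ scalar phi, (forall T, positive T -> 0 <= phi T) & phi 1 = 1].

(* Positivity of a matrix in M_n(B(H)), seen as an operator on H^n. *)
Definition positive_mx n (X : 'M[B]_n) := forall xi : 'I_n -> H,
  0 <= \sum_(i < n) \sum_(j < n) inner (X i j (xi j)) (xi i).

Definition completely_positive (Phi : B -> B) :=
  linear Phi /\
  forall n (X : 'M[B]_n), positive_mx X -> positive_mx (map_mx Phi X).

Definition unital_star_subalgebra (A : set B) :=
  [/\ A 1, (forall (a : R[i]) S T, A S -> A T -> A (a *: S + T)),
      (forall S T, A S -> A T -> A (S * T)) &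
      (forall S T, A S -> adjoint_of S T -> A T)].

Definition cstar_subalgebra (A : set B) := unital_star_subalgebra A /\ closed A.

Definition matrix_coefficients T : {ptws H * H -> R[i]} :=
  fun xy => inner (T xy.1) xy.2.

(* Closed in the weak operator topology: the coarsest topology making all the
   functions T |-> <T x, y> continuous. *)
Definition wot_closed (A : set B) :=
  closed (A : set (initial_topology matrix_coefficients)).

Definition von_neumann_algebra (A : set B) :=
  unital_star_subalgebra A /\ wot_closed A.

Definition fixed_by_cp (A : set B) : set B := [set T | forall Phi,
  completely_positive Phi -> (forall S, A S -> Phi S = S) -> Phi T = T].

End OperatorSpace.

(* Stone-Cech compactification of the discrete space T, as its set of
   ultrafilters; t : T corresponds to the principal ultrafilter at t. *)
Record beta (T : Type) := Beta {
  ultra :> set_system T;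
  ultraP : UltraFilter ultra }.

Lemma fmap_ultra (T U : Type) (f : T -> U) (F : set_system T) :
  UltraFilter F -> UltraFilter (fmap f F).
Proof.
move=> FU; split=> [|K KP FK]; first exact: fmap_proper_filter.
rewrite predeqE => A; split=> [KA|]; last exact: FK.
have [//|FA] := in_ultra_setVsetC (f @^-1` A) FU.
have KnA : K (~` A) by apply: FK.
by have /filter_ex[? []] : K (A `&` ~` A) by exact: filterI.
Qed.

Record linfty (R : realType) (T : Type) := Linfty {
  linfval :> T -> R[i];
  linfP : exists c : R, forall t, normc (linfval t) <= c }.
Arguments Linfty {R T} linfval linfP.

Section Extension.
Context {R : realType} {T : Type}.

(* Value at w of the continuous extension to beta T of a bounded function f. *)
Definition beta_ext (f : T -> R[i]) (w : beta T) : R[i] := lim (f @ ultra w).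

(* The last term covers the default value of lim; it is irrelevant for bounded f,
   whose limits along ultrafilters exist. *)
Lemma beta_ext_bounded (f : T -> R[i]) (c : R) : (forall t, normc (f t) <= c) ->
  forall w, normc (beta_ext f w) <= c + 1 + normc (point : R[i]).
Proof.
move=> fc w; have := ultraP w => wU.
have [t0 _] := @filter_ex _ (ultra w) _ setT filterT.
have c0 : 0 <= c by rewrite (le_trans _ (fc t0))// normc_ge0.
rewrite /beta_ext; have [cf|/dvgP ->] := pselect (cvg (f @ ultra w)); last first.
  by rewrite ler_wpDl// addr_ge0// ler01.
have /cvgrPdist_le /(_ 1 ltr01) fl := cf.
have [t /= ft] := filter_ex fl.
rewrite ler_wpDr ?normc_ge0// addrC.
rewrite -[lim _](subrK (f t)) (le_trans (le_normcD _ _))// lerD//.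
by rewrite -lecR.
Qed.

End Extension.

Section Group.
Context {R : realType} {G : groupType}.
Local Notation H := (l2 R G).
Local Notation B := (bop R G).

(* Extension of k |-> g * k to beta G. *)
Definition beta_act (g : G) (w : beta G) : beta G :=
  Beta (fmap_ultra (fun k => g * k)%g (ultraP w)).

Lemma mulop_l2 (f : linfty R G) c (x : H) : (forall k, normc (f k) <= c) ->
  (fun k => f k * x k) \in l2_pred /\ l2norm (fun k => f k * x k) <= c * l2norm x.
Proof.
move=> fc; have c0 : 0 <= c by rewrite (le_trans _ (fc 1%g))// normc_ge0.
apply/l2norm_leP; first by rewrite mulr_ge0 ?l2norm_ge0.
have xF := (l2norm_leP x (l2norm_ge0 x)).1 (conj (l2valP x) (lexx _)).
move=> F; rewrite exprMn (le_trans _ (ler_wpM2l (sqr_ge0 _) (xF F)))//.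
rewrite mulr_sumr; apply: ler_sum => i _.
rewrite ComplexField.Normc.normcM exprMn ler_wpM2r ?sqr_ge0//.
by rewrite lerXn2r ?nnegrE ?normc_ge0.
Qed.

Lemma mulop_l2_pred (f : linfty R G) (x : H) : (fun k => f k * x k) \in l2_pred.
Proof. by have [c fc] := linfP f; exact: (mulop_l2 x fc).1. Qed.

Lemma mulop_subproof (f : linfty R G) :
  ((fun x => L2 _ (mulop_l2_pred f x)) : H -> H) \in bounded_linear.
Proof.
rewrite unfold_in; apply/asboolP; split=> [a x y|].
  apply/val_inj/funext => k /=; rewrite [LHS]mulrDr.
  by congr (_ + _); rewrite mulrCA.
by have [c fc] := linfP f; exists c => x; exact: (mulop_l2 x fc).2.
Qed.

Definition mulop (f : linfty R G) : B := Bop _ (mulop_subproof f).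

Lemma regop_l2 (g : G) (x : H) :
  (fun k => x (g^-1 * k)%g) \in l2_pred /\
  l2norm (fun k => x (g^-1 * k)%g) <= 1 * l2norm x.
Proof.
rewrite mul1r; apply/l2norm_leP; first exact: l2norm_ge0.
have xF := (l2norm_leP x (l2norm_ge0 x)).1 (conj (l2valP x) (lexx _)).
move=> F; apply: le_trans (xF [fset (g^-1 * k)%g | k in F]%fset).
rewrite big_imfset//= => k k' _ _; exact: mulgI.
Qed.

Lemma regop_subproof (g : G) :
  ((fun x => L2 _ (regop_l2 g x).1) : H -> H) \in bounded_linear.
Proof.
rewrite unfold_in; apply/asboolP; split=> [a x y|]; first exact: val_inj.
by exists 1 => x; exact: (regop_l2 g x).2.
Qed.

(* Left regular representation: U_g e_h = e_(g h), see regop_basis. *)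
Definition regop (g : G) : B := Bop _ (regop_subproof g).

Lemma regop_basis g h : regop g (basis h) = basis (g * h)%g.
Proof.
apply/val_inj/funext => k /=; congr (nat_of_bool _)%:R.
by rewrite -(inj_eq (mulgI g)) mulVKg.
Qed.

Lemma E0_subproof (X : B) :
  exists c : R, forall g, normc (inner (X (basis g)) (basis g)) <= c.
Proof.
exists (opnorm X) => g; rewrite inner_basis (le_trans (normc_coord _ _))//.
rewrite (le_trans (l2norm_bop _ _))// ler_piMr ?opnorm_ge0//.
exact: l2norm_basis.
Qed.

(* The conditional expectation onto the diagonal operators. The algebra D of
   diagonal operators, i.e. the range of mulop, is identified with l^oo(G), so
   that E0, pure_state and pi_omega are stated on functions: the operator
   E_0(X) is mulop (E0 X). *)
Definition E0 (X : B) : linfty R G := Linfty _ (E0_subproof X).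

Definition pure_state (w : beta G) (f : linfty R G) : R[i] := beta_ext f w.

Lemma pi_omega_subproof (w : beta G) (f : linfty R G) :
  exists c : R, forall g, normc (beta_ext f (beta_act g w)) <= c.
Proof.
by have [c fc] := linfP f; eexists => g; exact: beta_ext_bounded fc _.
Qed.

Definition pi_omega (w : beta G) (f : linfty R G) : linfty R G :=
  Linfty _ (pi_omega_subproof w f).

Definition crossed_product : set B :=
  smallest cstar_subalgebra (range mulop `|` range regop).

Definition star_hom_on (A : set B) (rho : B -> B) :=
  [/\ forall (a : R[i]) S T, A S -> A T -> rho (a *: S + T) = a *: rho S + rho T,
      forall S T, A S -> A T -> rho (S * T) = rho S * rho T &
      forall S T, A S -> adjoint_of S T -> adjoint_of (rho S) (rho T)].

(* Finite sums are the eventually zero series. *)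
Definition is_pi_lambda (w : beta G) (rho : B -> B) :=
  star_hom_on crossed_product rho /\
  forall (f : nat -> linfty R G) (g : nat -> G) (T : B),
    series (fun n => mulop (f n) * regop (g n)) @ \oo --> T ->
    series (fun n => mulop (pi_omega w (f n)) * regop (g n)) @ \oo --> rho T.

(* Only the values of pi_lambda on crossed_product are determined. *)
Definition pi_lambda (w : beta G) : B -> B := get (is_pi_lambda w).

Definition image_algebra (w : beta G) : set B := pi_lambda w @` crossed_product.

Definition group_vna : set B := smallest von_neumann_algebra (range regop).

Definition is_regular_extension (w : beta G) (psi : B -> B) :=
  completely_positive psi /\
  forall (X : B) (g h : G), inner (psi X (basis h)) (basis g) =
    pure_state w (E0 (regop g^-1%g * X * regop h)).

(* There is exactly one such map, as the matrix entries determine psi X. *)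
Definition regular_extension (w : beta G) : B -> B :=
  get (is_regular_extension w).

End Group.

Arguments crossed_product R G : clear implicits.
Arguments group_vna R G : clear implicits.
Arguments pi_lambda R {G} w.
Arguments image_algebra R {G} w.
Arguments regular_extension R {G} w.

(* Main.v *)
Require Import Defs.
From HB Require Import structures.
From mathcomp Require Import all_boot all_order all_algebra.
From mathcomp Require Import all_classical all_reals all_analysis.
From mathcomp Require Import complex summability finmap ring.

Set Implicit Arguments.
Unset Strict Implicit.
Unset Printing Implicit Defensive.

Import Order.TTheory GRing.Theory Num.Theory.
Import numFieldNormedType.Exports.

Local Open Scope classical_set_scope.
Local Open Scope ring_scope.
Local Notation "x %:C" := (real_complex _ x) : ring_scope.

Local Notation basis := Defs.basis.

(** The compressions [rregop k^-1 * X * rregop k] of an operator by the right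
    translations have a weak operator limit [psi X] as [k] tends to the
    ultrafilter [w]. Its entry at [(g, h)] is the limit of the entries of [X] at
    [(g k, h k)], so [psi] is the regular extension ([regular_extensionE]), and
    its complete positivity is inherited from the compressions.

    The left translations [U_g], and with them all of VN(G), commute with the
    right translations, so [psi] fixes VN(G) pointwise
    ([limit_compression_group_vna]); this is the first inclusion.

    For the second one, let [Phi] be completely positive and fix [A_w]. The state
    [X |-> <Phi(psi X) e_1, e_1>] extends [s_w], because [psi] sends [M_f] to
    [pi_w(M_f)], which is in [A_w]. So does [X |-> <psi X e_1, e_1>]. By
    uniqueness the two states agree: [Phi(psi X)] and [psi X] have the same entry
    at [(1, 1)], for every [X]. Any other entry is the entry at [(1, 1)] of a
    translate [U_g^-1 X U_h], and both maps commute with these translations: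
    [psi] by construction, [Phi] because the unitaries that it fixes lie in its
    multiplicative domain ([choi_left], [choi_right]). Hence [Phi(psi X) = psi X].

    It has to be known that [A_w] contains [U_g] and [pi_w(M_f)]. Since
    [image_algebra] is defined from some homomorphism with the values prescribed
    for [pi_w x lambda], this asks that one exists; [psi] is one
    ([limit_compression_pi_lambda]). Indeed [psi] is multiplicative on the
    diagonal and fixes the [U_g], so by Choi's argument its multiplicative domain,
    a C*-algebra, contains the generators of the crossed product. *)

#[local] Existing Instance ultraP.
#[local] Existing Instance totally_filter.

(** * Limits of complex functions along filters and ultrafilters *)

Section ComplexLimits.
Context {R : realType} {T : Type} (F : set_system T) {FF : ProperFilter F}.
Local Notation C := R[i].
Implicit Types (f : T -> C) (l : C).

Lemma normCE (z : C) : `|z| = (normc z)%:C. Proof. by []. Qed.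

Lemma cvg_real_complex (f : T -> R) (a : R) :
  f @ F --> a -> (fun t => (f t)%:C) @ F --> a%:C.
Proof.
move=> /cvgrPdist_le fa; apply/cvgrPdist_le => e e0.
have [eI eR] : complex.Im e = 0 /\ 0 < complex.Re e.
  by move: e0; rewrite ltcE/= => /andP[/eqP].
near=> t; rewrite -rmorphB.
suff : `|a - f t| <= complex.Re e.
  move=> h; rewrite normc_def /= expr0n addr0 sqrtr_sqr.
  by rewrite lecE /= eI eqxx.
by near: t; exact: fa.
Unshelve. all: by end_near. Qed.

Lemma cvgC_unique f l l' : f @ F --> l -> f @ F --> l' -> l = l'.
Proof. by move=> fl fl'; apply: (cvg_unique _ fl fl'); exact: norm_hausdorff. Qed.

(** A nonnegative function is equal to its modulus, and the modulus is
    continuous. *)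
Lemma cvgC_ge0 f l : (forall t, 0 <= f t) -> f @ F --> l -> 0 <= l.
Proof.
move=> f0 fl; have fE : (fun t => `|f t|) = f.
  by apply/funext => t; rewrite ger0_norm.
have := @cvg_norm _ _ _ _ _ _ _ fl; rewrite fE => /(_ _) fnl.
by rewrite (cvgC_unique fl fnl).
Qed.

Lemma cvgC_le_norm f l (c : C) : (forall t, `|f t| <= c) -> f @ F --> l -> `|l| <= c.
Proof.
move=> fc fl; rewrite -subr_ge0.
apply: (@cvgC_ge0 (fun t => c - `|f t|)); first by move=> t; rewrite subr_ge0.
by apply: cvgB; [exact: cvg_cst|exact: cvg_norm].
Qed.

Lemma cvgC_conj f l : f @ F --> l -> (fun t => (f t)^*) @ F --> l^*.
Proof.
move=> /cvgrPdist_le fl; apply/cvgrPdist_le => e e0; near=> t.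
by rewrite -rmorphB norm_conjC; near: t; exact: fl.
Unshelve. all: by end_near. Qed.

Lemma cvgC_sum J (s : seq J) (f : J -> T -> C) (l : J -> C) :
  (forall j, f j @ F --> l j) ->
  (fun t => \sum_(j <- s) f j t) @ F --> \sum_(j <- s) l j.
Proof.
move=> fl; elim: s => [|j s IH].
  have -> : (fun t => \sum_(k <- [::]) f k t) = (fun=> 0).
    by apply/funext => t; rewrite big_nil.
  by rewrite big_nil; exact: cvg_cst.
have -> : (fun t => \sum_(k <- j :: s) f k t) =
    (fun t => f j t + \sum_(k <- s) f k t).
  by apply/funext => t; rewrite big_cons.
by rewrite big_cons; apply: cvgD; [exact: fl|exact: IH].
Qed.

End ComplexLimits.

Section UltraLimits.
Context {R : realType} {T : Type} (w : beta T).
Local Notation C := R[i].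

Lemma real_ultra_cvg (f : T -> R) (c : R) : (forall t, `|f t| <= c) ->
  exists l : R, f @ ultra w --> l.
Proof.
move=> fc; have := @segment_compact R (- c) c; rewrite compact_ultra.
move=> /(_ (f @ ultra w) (fmap_ultra f _)) [].
  apply: (@filterE _ (ultra w)) => t /=; rewrite in_itv /= -ler_norml; exact: fc.
by move=> l [_ fl]; exists l.
Qed.

(** Bounded functions converge along ultrafilters, by compactness of the two
    segments that contain their real and imaginary parts. *)
Lemma beta_ext_cvg (f : T -> C) (c : R) : (forall t, normc (f t) <= c) ->
  f @ ultra w --> beta_ext f w.
Proof.
move=> fc.
have Rc t : `|complex.Re (f t)| <= c.
  apply: le_trans (fc t); case: (f t) => a b /=.
  by rewrite -sqrtr_sqr ler_wsqrtr// lerDl sqr_ge0.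
have Ic t : `|complex.Im (f t)| <= c.
  apply: le_trans (fc t); case: (f t) => a b /=.
  by rewrite -sqrtr_sqr ler_wsqrtr// lerDr sqr_ge0.
have [u fu] := real_ultra_cvg Rc.
have [v fv] := real_ultra_cvg Ic.
apply: (@cvgP _ _ (u%:C + 'i%C * v%:C)).
have -> : f = (fun t => (complex.Re (f t))%:C + 'i%C * (complex.Im (f t))%:C).
  by apply/funext => t; rewrite -complexE.
apply: cvgD; first exact: cvg_real_complex.
by apply: cvgMr; exact: cvg_real_complex.
Qed.

End UltraLimits.

(** * The inner product of the sequence space *)

Section Inner.
Context {R : realType} {I : choiceType}.
Local Notation C := R[i].
Local Notation H := (l2 R I).
Implicit Types (x y z : H) (F : {fset I}).

Lemma fset_sqsum_le x F : \sum_(i <- F) normc (x i) ^+ 2 <= l2norm x ^+ 2.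
Proof.
exact: ((l2norm_leP x (l2norm_ge0 x)).1 (conj (l2valP x) (lexx _))).
Qed.

Lemma l2norm_le x (c : R) : 0 <= c ->
  (forall F, \sum_(i <- F) normc (x i) ^+ 2 <= c ^+ 2) -> l2norm x <= c.
Proof. by move=> c0 /(l2norm_leP x c0)[]. Qed.

(** The sums increase with the finite set, and [l2norm x ^+ 2] is their least
    upper bound. *)
Lemma fset_sqsum_cvg x :
  (fun F => \sum_(i <- F) normc (x i) ^+ 2) @ totally --> l2norm x ^+ 2.
Proof.
apply/cvgrPdist_le => e e0.
have [A lA] : exists A : {fset I},
    l2norm x ^+ 2 - e < \sum_(i <- A) normc (x i) ^+ 2.
  apply: contrapT => /forallNP sumle.
  have {}sumle F : \sum_(i <- F) normc (x i) ^+ 2 <= l2norm x ^+ 2 - e.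
    by rewrite leNgt; apply/negP; exact: sumle.
  have le0 : 0 <= l2norm x ^+ 2 - e by rewrite (le_trans _ (sumle fset0))// big_seq_fset0.
  have : l2norm x <= Num.sqrt (l2norm x ^+ 2 - e).
    by apply: l2norm_le => [|F]; rewrite ?sqrtr_ge0// sqr_sqrtr.
  rewrite -(@ler_pXn2r _ 2)// ?nnegrE ?sqrtr_ge0 ?l2norm_ge0// (sqr_sqrtr le0).
  by rewrite lerBrDr gerDl leNgt e0.
exists A => // B /= AB.
rewrite ger0_norm ?subr_ge0 ?fset_sqsum_le// lerBlDr -lerBlDl.
rewrite (le_trans (ltW lA))//.
rewrite (big_fsetID _ (mem A) B) /=.
have -> : [fset i in B | i \in A]%fset = A.
  by apply/fsetP => i; rewrite !inE andb_idl// => /(fsubsetP AB).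
by rewrite lerDl sumr_ge0// => i _; rewrite sqr_ge0.
Qed.

Lemma normc_sqE (z : C) : (normc z ^+ 2)%:C = z * z^*.
Proof. by rewrite rmorphXn/= -normCE normCK. Qed.

Lemma fset_sum_self_cvg x :
  (fun F => \sum_(i <- F) x i * (x i)^*) @ totally --> (l2norm x ^+ 2)%:C.
Proof.
have -> : (fun F => \sum_(i <- F) x i * (x i)^*) =
          (fun F => (\sum_(i <- F) normc (x i) ^+ 2)%:C).
  apply/funext => F; rewrite rmorph_sum/=; apply: eq_bigr => i _.
  by rewrite normc_sqE.
by apply: cvg_real_complex; exact: fset_sqsum_cvg.
Qed.

Lemma polarization (a b : C) : a * b^* =
  4^-1 * ((a + b) * (a + b)^* - (a - b) * (a - b)^*
    + 'i * ((a + 'i * b) * (a + 'i * b)^* - (a - 'i * b) * (a - 'i * b)^*)).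
Proof.
have iC : ('i : C)^* = - 'i by exact: conjCi.
rewrite !(rmorphD, rmorphN, rmorphM)/= !iC.
have i2 : ('i : C) ^+ 2 = -1 by exact: sqrCi.
have n4 : (4 : C) != 0 by rewrite pnatr_eq0.
apply: (mulfI n4); rewrite mulVKf//.
(* The two sides differ by a multiple of ['i ^+ 2 + 1]. *)
apply/eqP; rewrite -subr_eq0; apply/eqP.
transitivity (2 * (1 + 'i ^+ 2) * (a * b^* - a^* * b)); last first.
  by rewrite i2 subrr mulr0 mul0r.
ring.
Qed.

(** The net of finite partial sums defining the inner product converges: by
    polarization it is a combination of four monotone bounded nets. *)
Lemma inner_cvg x y :
  (fun F => \sum_(i <- F) x i * (y i)^*) @ totally --> inner x y.
Proof.
have psE : partial_sum (fun i => x i * (y i)^*) =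
    (fun F => \sum_(i <- F) x i * (y i)^*).
  by apply/funext => F; rewrite /partial_sum big_seq_fsetE.
rewrite /inner /summability.sum -psE.
pose P (u v : H) : C := 4^-1 * ((l2norm (u + v) ^+ 2)%:C - (l2norm (u - v) ^+ 2)%:C
  + 'i * ((l2norm (u + ('i : C) *: v) ^+ 2)%:C - (l2norm (u - ('i : C) *: v) ^+ 2)%:C)).
apply: (@cvgP _ _ (P x y)); rewrite psE.
have -> : (fun F => \sum_(i <- F) x i * (y i)^*) = (fun F =>
    4^-1 * (\sum_(i <- F) (x + y) i * ((x + y) i)^*
      - \sum_(i <- F) (x - y) i * ((x - y) i)^*
      + 'i * (\sum_(i <- F) (x + ('i : C) *: y) i * ((x + ('i : C) *: y) i)^*
      - \sum_(i <- F) (x - ('i : C) *: y) i * ((x - ('i : C) *: y) i)^*))).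
  apply/funext => F; rewrite -!sumrB mulr_sumr -big_split/= mulr_sumr.
  by apply: eq_bigr => i _; rewrite polarization.
apply: cvgMr; apply: cvgD; first by apply: cvgB; exact: fset_sum_self_cvg.
by apply: cvgMr; apply: cvgB; exact: fset_sum_self_cvg.
Qed.

Lemma innerE x y (l : C) :
  (fun F => \sum_(i <- F) x i * (y i)^*) @ totally --> l -> inner x y = l.
Proof. exact/cvgC_unique/inner_cvg. Qed.

Lemma innerP (a : C) x y z : inner (a *: x + y) z = a * inner x z + inner y z.
Proof.
apply: innerE.
have -> : (fun F => \sum_(i <- F) (a *: x + y) i * (z i)^*) = (fun F =>
    a * (\sum_(i <- F) x i * (z i)^*) + \sum_(i <- F) y i * (z i)^*).
  apply/funext => F; rewrite mulr_sumr -big_split/=; apply: eq_bigr => i _.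
  by rewrite mulrA -mulrDl.
by apply: cvgD; [apply: cvgMr|]; exact: inner_cvg.
Qed.

Lemma inner_conj x y : (inner x y)^* = inner y x.
Proof.
apply/esym/innerE.
have -> : (fun F => \sum_(i <- F) y i * (x i)^*) =
    (fun F => (\sum_(i <- F) x i * (y i)^*)^*).
  apply/funext => F; rewrite rmorph_sum/=; apply: eq_bigr => i _.
  by rewrite rmorphM/= conjCK mulrC.
by apply: cvgC_conj; exact: inner_cvg.
Qed.

Lemma inner_self x : inner x x = (l2norm x ^+ 2)%:C.
Proof. exact/innerE/fset_sum_self_cvg. Qed.

Lemma inner_self_ge0 x : 0 <= inner x x.
Proof. by rewrite inner_self ler0c sqr_ge0. Qed.

Lemma innerDl x y z : inner (x + y) z = inner x z + inner y z.
Proof. by rewrite -[x in x + y]scale1r innerP mul1r. Qed.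

Lemma inner0l y : inner 0 y = 0.
Proof. by apply: (addIr (inner 0 y)); rewrite -innerDl !add0r. Qed.

Lemma innerZl (a : C) x y : inner (a *: x) y = a * inner x y.
Proof. by rewrite -[a *: x]addr0 innerP inner0l addr0. Qed.

Lemma innerNl x y : inner (- x) y = - inner x y.
Proof. by rewrite -scaleN1r innerZl mulN1r. Qed.

Lemma innerBl x y z : inner (x - y) z = inner x z - inner y z.
Proof. by rewrite innerDl innerNl. Qed.

Lemma innerDr x y z : inner x (y + z) = inner x y + inner x z.
Proof. by rewrite -inner_conj innerDl rmorphD/= !inner_conj. Qed.

Lemma innerZr (a : C) x y : inner x (a *: y) = a^* * inner x y.
Proof. by rewrite -inner_conj innerZl rmorphM/= inner_conj. Qed.

Lemma innerNr x y : inner x (- y) = - inner x y.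
Proof. by rewrite -inner_conj innerNl rmorphN/= inner_conj. Qed.

Lemma innerBr x y z : inner x (y - z) = inner x y - inner x z.
Proof. by rewrite innerDr innerNr. Qed.

Lemma inner_suml J (s : seq J) (P : pred J) (f : J -> H) y :
  inner (\sum_(j <- s | P j) f j) y = \sum_(j <- s | P j) inner (f j) y.
Proof. by apply: (big_morph (inner^~ y)) => [u v|]; rewrite ?innerDl ?inner0l. Qed.

Lemma inner_sumr J (s : seq J) (P : pred J) (f : J -> H) x :
  inner x (\sum_(j <- s | P j) f j) = \sum_(j <- s | P j) inner x (f j).
Proof.
rewrite -inner_conj inner_suml rmorph_sum/=.
by apply: eq_bigr => j _; rewrite inner_conj.
Qed.

Lemma inner_basisr i y : inner (basis i) y = (y i)^*.
Proof. by rewrite -inner_conj inner_basis. Qed.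

Lemma l2_ext x y : (forall z, inner x z = inner y z) -> x = y.
Proof.
by move=> xy; apply/val_inj/funext => i; have := xy (basis i); rewrite !inner_basis.
Qed.

Lemma norm_inner_le x y : `|inner x y| <= (l2norm x * l2norm y)%:C.
Proof.
have [x0|x0] := eqVneq (l2norm x) 0.
  have -> : x = 0 by apply: l2_norm_eq0; rewrite x0.
  by rewrite inner0l normr0 ler0c mulr_ge0 ?l2norm_ge0.
have xp : 0 < l2norm x ^+ 2 by rewrite exprn_gt0// lt_def x0 l2norm_ge0.
pose X : C := inner x x; pose Z : C := inner y x.
have XE : X = (l2norm x ^+ 2)%:C by exact: inner_self.
have X0 : 0 < X by rewrite XE ltcR.
(* [X *: y - Z *: x] is [X] times the component of [y] orthogonal to [x]. *)
have := inner_self_ge0 (X *: y - Z *: x).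
rewrite innerBl !innerBr !innerZl !innerZr -/X -/Z -(inner_conj y x) -/Z.
rewrite (geC0_conj (ltW X0)) inner_self => h.
have {}h : 0 <= X * (X * (l2norm y ^+ 2)%:C - Z * Z^*).
  by apply: le_trans h _; rewrite le_eqVlt; apply/orP; left; apply/eqP; ring.
rewrite pmulr_rge0// subr_ge0 -normCK XE -rmorphM -exprMn rmorphXn/= in h.
rewrite norm_conjC.
by rewrite -(@ler_pXn2r _ 2)// ?nnegrE ?normr_ge0 ?ler0c ?mulr_ge0 ?l2norm_ge0.
Qed.

Lemma cauchy_schwarz x y : `|inner x y| <= `|x| * `|y|.
Proof. by rewrite !l2normE -rmorphM/= norm_inner_le. Qed.

Lemma norm_inner_self x : `|x| ^+ 2 = inner x x.
Proof. by rewrite inner_self l2normE rmorphXn. Qed.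

Definition truncate F (c : I -> C) : H := \sum_(i <- F) c i *: basis i.

Lemma inner_truncate (c : I -> C) y F :
  inner (truncate F c) y = \sum_(i <- F) c i * (y i)^*.
Proof.
by rewrite inner_suml; apply: eq_bigr => i _; rewrite innerZl inner_basisr.
Qed.

Lemma inner_truncate_self (c : I -> C) F :
  inner (truncate F c) (truncate F c) = \sum_(i <- F) c i * (c i)^*.
Proof.
rewrite /truncate inner_suml big_seq [RHS]big_seq; apply: eq_bigr => i iF.
rewrite innerZl inner_sumr (big_fsetD1 i)//= innerZr inner_basis/= eqxx mulr1.
rewrite big_seq big1 ?addr0// => j; rewrite !inE => /andP[ji _].
by rewrite innerZr inner_basis/= (negPf ji) mulr0.
Qed.

(** By Pythagoras, the squared distance to the truncation is the tail of the
    series of the squared norm. *)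
Lemma truncate_cvg x : truncate^~ x @ totally --> x.
Proof.
have dE F : `|x - truncate F x| ^+ 2 =
    (l2norm x ^+ 2)%:C - \sum_(i <- F) x i * (x i)^*.
  have sr : (\sum_(i <- F) x i * (x i)^*)^* = \sum_(i <- F) x i * (x i)^* :> C.
    by rewrite rmorph_sum/=; apply: eq_bigr => i _; rewrite rmorphM/= conjCK mulrC.
  rewrite norm_inner_self innerBl !innerBr inner_truncate_self.
  rewrite -(inner_conj (truncate F x) x).
  by rewrite !inner_truncate sr inner_self subrr subr0.
apply/cvgrPdist_le => e e0.
have /cvgrPdist_le/(_ (e ^+ 2)) := @fset_sum_self_cvg x.
rewrite exprn_gt0// => /(_ isT); apply: filterS => F.
rewrite -dE normrX normr_id ler_pXn2r// ?nnegrE ?normr_ge0//.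
exact: ltW.
Qed.

End Inner.

(** * Adjoints and weak convergence *)

Section Adjoint.
Context {R : realType} {I : choiceType}.
Local Notation C := R[i].
Local Notation H := (l2 R I).
Local Notation B := (bop R I).
Implicit Types (x y z : H) (S T : B).

Lemma cvg_lipschitz (U : Type) (F : set_system U) (FF : ProperFilter F)
    (V W : normedModType C) (f : U -> V) (g : U -> W) (l : V) (m : W) (K : C) :
  0 <= K -> (forall t, `|m - g t| <= K * `|l - f t|) ->
  f @ F --> l -> g @ F --> m.
Proof.
move=> K0 gf /cvgrPdist_le fl; apply/cvgrPdist_le => e e0.
have K1 : 0 < K + 1 by rewrite ltr_wpDl.
have := fl (e / (K + 1)); rewrite divr_gt0// => /(_ isT).
apply: filterS => t ft; rewrite (le_trans (gf t))//.
rewrite (le_trans (ler_wpM2l K0 ft))// mulrA ler_pdivrMr// mulrC.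
by rewrite ler_wpM2l ?ltW// ltrDl.
Qed.

Lemma norm_bop_le T x : `|T x| <= (opnorm T)%:C * `|x|.
Proof. by rewrite !l2normE -rmorphM lecR l2norm_bop. Qed.

Lemma cvg_bop (U : Type) (F : set_system U) (FF : ProperFilter F)
    T (f : U -> H) x : f @ F --> x -> (T \o f) @ F --> T x.
Proof.
apply: (@cvg_lipschitz _ _ _ _ _ _ _ _ _ (opnorm T)%:C); first by rewrite ler0c opnorm_ge0.
by move=> t; rewrite /= -linearB norm_bop_le.
Qed.

Lemma cvg_innerl (U : Type) (F : set_system U) (FF : ProperFilter F)
    (f : U -> H) x y : f @ F --> x -> (fun t => inner (f t) y) @ F --> inner x y.
Proof.
apply: (@cvg_lipschitz _ _ _ _ C^o _ _ _ _ (l2norm y)%:C).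
  by rewrite ler0c l2norm_ge0.
by move=> t; rewrite -innerBl l2normE -rmorphM/= mulrC norm_inner_le.
Qed.

(** Coordinatewise convergence of a bounded family is weak convergence: a
    finite truncation of the test vector costs little, uniformly in the family. *)
Lemma cvg_inner_bounded (U : Type) (F : set_system U) (FF : ProperFilter F)
    (f : U -> H) (c : R) x y :
  (forall t, l2norm (f t) <= c) -> (forall i, (fun t => f t i) @ F --> x i) ->
  (fun t => inner (f t) y) @ F --> inner x y.
Proof.
move=> fc fx; pose K : C := (l2norm x + c)%:C.
have [t0 _] := @filter_ex _ F _ setT filterT.
have c0 : 0 <= c by rewrite (le_trans _ (fc t0))// l2norm_ge0.
have K0 : 0 <= K by rewrite ler0c addr_ge0 ?l2norm_ge0.
have K1 : 0 < K + 1 by rewrite ltr_wpDl.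
apply/cvgrPdist_le => e e0; have e2 : 0 < e / 2 by rewrite divr_gt0.
have /cvgrPdist_le/(_ (e / 2 / (K + 1))) := @truncate_cvg _ _ y.
rewrite divr_gt0// => /(_ isT)/filter_ex[A yA].
have tl : (fun t => inner (f t) (truncate A y)) @ F --> inner x (truncate A y).
  have iE z : inner z (truncate A y) = \sum_(i <- A) z i * (y i)^*.
    rewrite -inner_conj inner_truncate rmorph_sum/=; apply: eq_bigr => i _.
    by rewrite rmorphM/= conjCK mulrC.
  have -> : (fun t => inner (f t) (truncate A y)) =
      (fun t => \sum_(i <- A) f t i * (y i)^*) by apply/funext => t; exact: iE.
  rewrite iE.
  by apply: cvgC_sum => i; apply: cvgMl; exact: fx.
move/cvgrPdist_le: tl => /(_ _ e2); apply: filterS => t ht.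
rewrite -innerBl -(subrK (truncate A y) y) innerDr.
rewrite (le_trans (ler_normD _ _))// [leRHS]splitr.
apply: lerD; last first.
  by rewrite innerBl; exact: ht.
apply: le_trans (cauchy_schwarz _ _) _.
apply: (@le_trans _ _ (K * (e / 2 / (K + 1)))).
  apply: ler_pM; [exact: normr_ge0|exact: normr_ge0| |exact: yA].
  rewrite (le_trans (ler_normB _ _))// !l2normE -rmorphD lecR lerD2l.
  exact: fc.
rewrite mulrA ler_pdivrMr// mulrC.
by rewrite ler_wpM2l ?ltW// ltrDl.
Qed.

(** Let [z] be a finite truncation of the candidate vector. Its squared norm is
    [<y, T z>], hence at most [l2norm y * opnorm T * l2norm z]: this bounds the
    norm of [z] uniformly in the truncation. *)
Lemma adjoint_l2 T y : exists z : H, forall i, z i = inner y (T (basis i)).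
Proof.
pose c i : C := inner y (T (basis i)).
suff cl2 : c \in l2_pred by exists (L2 _ cl2).
pose K := l2norm y * opnorm T.
have K0 : 0 <= K by rewrite mulr_ge0 ?l2norm_ge0 ?opnorm_ge0.
suff /(l2norm_leP c K0)[] : forall A : {fset I}, \sum_(i <- A) normc (c i) ^+ 2 <= K ^+ 2 by [].
move=> A; pose s := \sum_(i <- A) normc (c i) ^+ 2.
have sE : s%:C = \sum_(i <- A) c i * (c i)^*.
  by rewrite rmorph_sum/=; apply: eq_bigr => i _; rewrite normc_sqE.
pose z := truncate A c.
have sz : s = l2norm z ^+ 2.
  by apply: complexI; rewrite -inner_self inner_truncate_self.
have sT : s%:C = inner y (T z).
  rewrite sE linear_sum inner_sumr; apply: eq_bigr => i _.
  by rewrite linearZ innerZr mulrC.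
have : s <= K * l2norm z.
  have := norm_inner_le y (T z).
  rewrite -sT ger0_norm ?ler0c ?sumr_ge0// => [|i _]; last by rewrite sqr_ge0.
  rewrite lecR => /le_trans; apply.
  by rewrite /K -mulrA ler_wpM2l ?l2norm_ge0// l2norm_bop.
rewrite -/s sz; have [->|z0] := eqVneq (l2norm z) 0.
  by rewrite expr0n/= sqr_ge0.
have zp : 0 < l2norm z by rewrite lt_def z0 l2norm_ge0.
by rewrite expr2 ler_pM2r// => zK; rewrite -expr2 ler_pXn2r// nnegrE l2norm_ge0.
Qed.

(** The coordinates of the adjoint at [y] are forced on the basis; the defining
    identity then extends along the finite truncations of [x]. *)
Lemma adjoint_exists T : exists S, adjoint_of T S.
Proof.
have [f fE] := choice (adjoint_l2 T).
have adjf x y : inner (T x) y = inner x (f y).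
  apply: (@cvgC_unique _ _ totally).
    by apply: cvg_innerl; apply: cvg_bop; exact: truncate_cvg.
  have -> : (fun F => inner ((T \o truncate^~ x) F) y) =
      (fun F => \sum_(i <- F) x i * (f y i)^*); last exact: inner_cvg.
  apply/funext => F /=; rewrite linear_sum inner_suml; apply: eq_bigr => i _.
  by rewrite linearZ innerZl fE inner_conj.
suff fB : f \in bounded_linear by exists (Bop f fB).
rewrite unfold_in; apply/asboolP; split=> [a x y|].
  apply: l2_ext => z.
  by rewrite innerP -!(inner_conj z) -!adjf innerDr innerZr !rmorphD !rmorphM/= conjCK.
exists (opnorm T) => x; have [->|fx0] := eqVneq (l2norm (f x)) 0.
  by rewrite mulr_ge0 ?opnorm_ge0 ?l2norm_ge0.
have fxp : 0 < l2norm (f x) by rewrite lt_def fx0 l2norm_ge0.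
rewrite -(ler_pM2l fxp) -expr2 -lecR -inner_self.
have := norm_inner_le (T (f x)) x.
rewrite adjf ger0_norm ?inner_self_ge0// => /le_trans; apply; rewrite lecR.
by rewrite mulrA ler_wpM2r ?l2norm_ge0// mulrC l2norm_bop.
Qed.

Lemma adjoint_ofC S T : adjoint_of S T -> adjoint_of T S.
Proof. by move=> ST x y; rewrite -inner_conj -ST inner_conj. Qed.

Lemma adjoint_ofM S S' T T' :
  adjoint_of S S' -> adjoint_of T T' -> adjoint_of (S * T) (T' * S').
Proof. by move=> SS TT x y; rewrite [LHS]SS [LHS]TT. Qed.

Lemma adjoint_of_inj T S S' : adjoint_of T S -> adjoint_of T S' -> S = S'.
Proof.
move=> TS TS'; apply/val_inj/funext => x; apply: l2_ext => y.
by rewrite (adjoint_ofC TS) (adjoint_ofC TS').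
Qed.

End Adjoint.

(** * Completely positive maps and multiplicative domains *)

Section CompletelyPositive.
Context {R : realType} {I : choiceType}.
Local Notation C := R[i].
Local Notation H := (l2 R I).
Local Notation B := (bop R I).
Implicit Types (x y z : H) (S T : B).

(** The values of the form are real, and its values at [1], [- 1], ['i] and
    [- 'i] recover [2 * (b + b')] and [2 * 'i * (b - b')]; so [b + b'] is real
    and [b - b'] imaginary. *)
Lemma nonneg_hermitian (a b b' d : C) :
  (forall t : C, 0 <= a + t * b + t^* * b' + t * t^* * d) -> b' = b^*.
Proof.
move=> pos; pose q t := a + t * b + t^* * b' + t * t^* * d.
have qr t : (q t)^* = q t by apply: geC0_conj; exact: pos.
have iC : ('i : C)^* = - 'i by exact: conjCi.
have i2 : ('i : C) ^+ 2 = -1 by exact: sqrCi.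
have h1 : (b + b')^* = b + b'.
  have -> : b + b' = 2^-1 * (q 1 - q (-1)).
    by rewrite /q rmorphN !conjC1; field; rewrite ?pnatr_eq0.
  by rewrite rmorphM rmorphB/= !qr fmorphV/= conjC_nat.
have h2 : (b - b')^* = - (b - b').
  have -> : b - b' = - ('i * (2^-1 * (q 'i - q (- 'i)))).
    rewrite /q rmorphN/= iC.
    transitivity (- ('i ^+ 2 * (b - b'))); first by rewrite i2; ring.
    by field.
  by rewrite !(rmorphN, rmorphM, rmorphB)/= !qr fmorphV/= conjC_nat iC mulNr.
apply: (mulfI (_ : (2 : C) != 0)); first by rewrite pnatr_eq0.
transitivity ((b + b') - (b - b')); first by ring.
by rewrite -h1 -h2 rmorphD rmorphB/=; ring.
Qed.

(** At [t = - s * b^*], with [s] real, the form is [- 2 * s * `|b| ^+ 2] up to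
    second order in [s]; this is negative for small positive [s] unless [b = 0]. *)
Lemma nonneg_isotropic (b b' d : C) :
  (forall t : C, 0 <= t * b + t^* * b' + t * t^* * d) -> b = 0.
Proof.
move=> pos; have b'E : b' = b^*.
  by apply: (@nonneg_hermitian 0 _ _ d) => t; rewrite add0r.
have d0 : 0 <= d.
  suff : 0 <= 2 * d by rewrite pmulr_rge0.
  have := addr_ge0 (pos 1) (pos (-1)); rewrite rmorphN !conjC1.
  by move=> h; apply: le_trans h _; rewrite le_eqVlt; apply/orP; left; apply/eqP; ring.
have d1 : 0 < d + 1 by rewrite ltr_wpDl.
have sC : ((d + 1)^-1)^* = (d + 1)^-1 by apply: geC0_conj; rewrite invr_ge0 ltW.
(* This is the value at [s = (d + 1)^-1], small enough for the linear term to
   dominate. *)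
have : 0 <= - ((d + 2) / (d + 1) ^+ 2 * (b * b^*)).
  have := pos (- (d + 1)^-1 * b^*); rewrite b'E rmorphM/= rmorphN/= sC conjCK.
  move=> h; apply: le_trans h _; rewrite le_eqVlt; apply/orP; left; apply/eqP.
  by field; rewrite gt_eqF.
rewrite oppr_ge0 -normCK pmulr_rle0; last first.
  by rewrite divr_gt0 ?exprn_gt0// ltr_wpDl.
move=> h; apply/eqP; rewrite -normr_eq0 -sqrf_eq0; apply/eqP/le_anti.
by rewrite h exprn_ge0.
Qed.

(** The Gram matrix [A_i^* A_j] is positive: its form at [eta] is the squared norm
    of the sum of the [A_i eta_i]. *)
Lemma cp_gram (Phi : B -> B) n (A A' : 'I_n -> B) (xi : 'I_n -> H) :
  completely_positive Phi -> (forall i, adjoint_of (A i) (A' i)) ->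
  0 <= \sum_(i < n) \sum_(j < n) inner (Phi (A' i * A j) (xi j)) (xi i).
Proof.
move=> [_ cp] AA'.
have := cp n (\matrix_(i, j) (A' i * A j)) _ xi.
under eq_bigr do under eq_bigr do rewrite !mxE; apply => eta.
have -> : \sum_(i < n) \sum_(j < n)
      inner ((\matrix_(i, j) (A' i * A j)) i j (eta j)) (eta i) =
    inner (\sum_(i < n) A i (eta i)) (\sum_(i < n) A i (eta i)).
  rewrite inner_sumr; apply: eq_bigr => i _.
  rewrite inner_suml; apply: eq_bigr => j _.
  by rewrite mxE/= -(adjoint_ofC (AA' i)).
exact: inner_self_ge0.
Qed.

Lemma adjoint_of1 : adjoint_of (1 : B) 1.
Proof. by []. Qed.

(** The image of the Gram matrix of [1, T] is positive, hence hermitian. *)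
Lemma cp_adjoint (Phi : B -> B) T T' :
  completely_positive Phi -> adjoint_of T T' -> adjoint_of (Phi T) (Phi T').
Proof.
move=> cp TT' y x; rewrite -(inner_conj (Phi T' x)).
apply/esym/(canLR (@conjCK _)).
apply: (@nonneg_hermitian (inner (Phi 1 x) x) _ _ (inner (Phi (T' * T) y) y)) => t.
pose A (i : 'I_2) := if i == ord0 then 1 : B else T.
pose A' (i : 'I_2) := if i == ord0 then 1 : B else T'.
pose xi (i : 'I_2) := if i == ord0 then x else t *: y.
have AA' i : adjoint_of (A i) (A' i).
  by rewrite /A /A'; case: ifP => _ //; exact: adjoint_of1.
have := cp_gram xi cp AA'.
rewrite !big_ord_recl !big_ord0 /A /A' /xi /= !addr0 !mul1r !mulr1.
rewrite !linearZ !innerZl !innerZr.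
move=> h; apply: le_trans h _; rewrite le_eqVlt; apply/orP; left; apply/eqP.
by ring.
Qed.

(** Choi's multiplicative domain argument. The image under [Phi] of the Gram matrix
    of [1, S, Y] is positive, and its form vanishes at [(- Phi(S) x, x, 0)]; so the
    cross term of this vector with any [(0, 0, y)] vanishes too, and that term is
    the pairing of [Phi (S' * Y) y - Phi S' (Phi Y y)] with [x]. *)
Lemma choi_left (Phi : B -> B) S S' Y : completely_positive Phi -> Phi 1 = 1 ->
  adjoint_of S S' -> Phi (S' * S) = Phi S' * Phi S ->
  Phi (S' * Y) = Phi S' * Phi Y.
Proof.
move=> cp Phi1 SS' PSS; have PS := cp_adjoint cp SS'.
have [Y' YY'] := adjoint_exists Y.
apply/val_inj/funext => y; apply: l2_ext => x /=.
apply/eqP; rewrite -subr_eq0; apply/eqP.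
pose u := Phi S x.
apply: (@nonneg_isotropic _ (- inner (Phi Y' u) y + inner (Phi (Y' * S) x) y)
  (inner (Phi (Y' * Y) y) y)) => t.
pose A (i : 'I_3) := if i == 0 :> nat then 1 : B else if i == 1 :> nat then S else Y.
pose A' (i : 'I_3) := if i == 0 :> nat then 1 : B else if i == 1 :> nat then S' else Y'.
pose xi (i : 'I_3) := if i == 0 :> nat then - u else if i == 1 :> nat then x else t *: y.
have AA' i : adjoint_of (A i) (A' i).
  by rewrite /A /A'; case: ifP => _; [exact: adjoint_of1|case: ifP].
have := cp_gram xi cp AA'.
rewrite !big_ord_recl !big_ord0 /A /A' /xi /= !addr0 !mul1r !mulr1.
rewrite Phi1 PSS !(linearN, linearZ) /= !(innerZl, innerZr, innerNl, innerNr).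
have e1 : inner (Phi S' u) x = inner u u by rewrite -(adjoint_ofC PS).
have e2 : inner (Phi S' (Phi S x)) x = inner u u by exact: e1.
have e3 : inner (Phi S' (Phi Y y)) x = inner (Phi Y y) u.
  by rewrite -(adjoint_ofC PS).
rewrite e1 ?e2 ?e3 /=.
move=> h; apply: le_trans h _; rewrite le_eqVlt; apply/orP; left; apply/eqP.
by ring.
Qed.

(** The adjoint of [choi_left], applied to the adjoint of [Y]. *)
Lemma choi_right (Phi : B -> B) S S' Y : completely_positive Phi -> Phi 1 = 1 ->
  adjoint_of S S' -> Phi (S' * S) = Phi S' * Phi S ->
  Phi (Y * S) = Phi Y * Phi S.
Proof.
move=> cp Phi1 SS' PSS; have [Y' YY'] := adjoint_exists Y.
have PS := cp_adjoint cp SS'; have PY := cp_adjoint cp YY'.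
apply: (@adjoint_of_inj _ _ (Phi (S' * Y'))).
  by apply: cp_adjoint => //; apply: adjoint_ofC; exact: adjoint_ofM.
rewrite (choi_left _ cp Phi1 SS' PSS).
by apply: adjoint_ofC; exact: adjoint_ofM.
Qed.

End CompletelyPositive.

(** * The weak limit of compressions by right translations *)

Section OperatorFacts.
Context {R : realType} {I : choiceType}.
Local Notation C := R[i].
Local Notation H := (l2 R I).
Local Notation B := (bop R I).
Implicit Types (x y z : H) (S T : B).

(** As the adjoint exists, it is enough to match its coordinates; no sum defining
    an inner product has to be reindexed. *)
Lemma adjoint_of_basisP S T :
  (forall y i, inner y (T (basis i)) = S y i) -> adjoint_of T S.
Proof.
move=> ST; have [T' TT'] := adjoint_exists T.
suff <- : T' = S by [].
apply/val_inj/funext => y; apply/val_inj/funext => i.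
transitivity (inner y (T (basis i))); last exact: ST.
by rewrite -(adjoint_ofC TT') inner_basis.
Qed.

Lemma bop_ext_basis S T :
  (forall g h, inner (S (basis h)) (basis g) = inner (T (basis h)) (basis g)) ->
  S = T.
Proof.
move=> ST; have [S' SS'] := adjoint_exists S.
apply: (@adjoint_of_inj _ _ S'); first exact: adjoint_ofC.
apply/adjoint_ofC/adjoint_of_basisP => y i.
transitivity (inner (S' y) (basis i)); last exact: inner_basis.
rewrite (adjoint_ofC SS').
suff -> : T (basis i) = S (basis i) by [].
apply/val_inj/funext => g; rewrite -[RHS]inner_basis ST.
by rewrite inner_basis.
Qed.

Lemma inner_bop_le T x y :
  `|inner (T x) y| <= (opnorm T * l2norm x * l2norm y)%:C.
Proof.
apply: le_trans (norm_inner_le _ _) _; rewrite lecR ler_wpM2r ?l2norm_ge0//.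
exact: l2norm_bop.
Qed.

Lemma opnorm_le_inner T (c : R) : 0 <= c ->
  (forall x y, `|inner (T x) y| <= (c * l2norm x * l2norm y)%:C) -> opnorm T <= c.
Proof.
move=> c0 Tc; apply: opnorm_le => // x.
have [->|Tx0] := eqVneq (l2norm (T x)) 0; first by rewrite mulr_ge0 ?l2norm_ge0.
have Txp : 0 < l2norm (T x) by rewrite lt_def Tx0 l2norm_ge0.
have := Tc x (T x); rewrite inner_self ger0_norm ?ler0c ?sqr_ge0//.
by rewrite lecR expr2 ler_pM2r.
Qed.

Lemma opnormM S T : opnorm (S * T) <= opnorm S * opnorm T.
Proof.
apply: opnorm_le => [|x]; first by rewrite mulr_ge0 ?opnorm_ge0.
apply: le_trans (l2norm_bop S (T x)) _.
by rewrite -mulrA ler_wpM2l ?opnorm_ge0// l2norm_bop.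
Qed.

(** Weak compactness of balls, along one ultrafilter: the coordinates converge,
    and every finite sum of their squared moduli keeps its bound in the limit. *)
Lemma ultra_weak_limit (U : Type) (w : beta U) (f : U -> H) (c : R) :
  (forall t, l2norm (f t) <= c) ->
  exists x, l2norm x <= c /\
    forall y, (fun t => inner (f t) y) @ ultra w --> inner x y.
Proof.
move=> fc; pose l i : C := beta_ext (fun t => f t i) w.
have [t0 _] := @filter_ex _ (ultra w) _ setT filterT.
have c0 : 0 <= c by rewrite (le_trans _ (fc t0))// l2norm_ge0.
have fl i : (fun t => f t i) @ ultra w --> l i.
  apply: (@beta_ext_cvg _ _ _ _ c) => t.
  by apply: le_trans (fc t); exact: normc_coord.
have lc (F : {fset I}) : \sum_(i <- F) normc (l i) ^+ 2 <= c ^+ 2.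
  rewrite -lecR rmorph_sum/=; under eq_bigr do rewrite normc_sqE.
  rewrite -subr_ge0.
  apply: (@cvgC_ge0 _ _ (ultra w) _
    (fun t => (c ^+ 2)%:C - \sum_(i <- F) f t i * (f t i)^*)).
    move=> t; rewrite subr_ge0; under eq_bigr do rewrite -normc_sqE.
    rewrite -rmorph_sum/= lecR; apply: le_trans (fset_sqsum_le (f t) F) _.
    by rewrite ler_pXn2r ?nnegrE ?l2norm_ge0.
  apply: cvgB; first exact: cvg_cst.
  apply: cvgC_sum => i; apply: cvgM; first exact: fl.
  by apply: cvgC_conj; exact: fl.
have [lf lle] := (l2norm_leP l c0).2 lc.
exists (L2 l lf); split=> // y.
by apply: cvg_inner_bounded fc _ => i; exact: fl.
Qed.

End OperatorFacts.

Section Translations.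
Context {R : realType} {G : groupType}.
Local Notation C := R[i].
Local Notation H := (l2 R G).
Local Notation B := (bop R G).
Implicit Types (x y z : H) (S T X Y : B) (w : beta G).

Lemma rregop_l2 (k : G) (x : H) :
  (fun j => x (j * k^-1)%g) \in l2_pred /\
  l2norm (fun j => x (j * k^-1)%g) <= l2norm x.
Proof.
apply/l2norm_leP; first exact: l2norm_ge0.
move=> F; apply: le_trans (fset_sqsum_le x [fset (j * k^-1)%g | j in F]%fset).
by rewrite big_imfset//= => j j' _ _; exact: mulIg.
Qed.

Lemma rregop_subproof (k : G) :
  ((fun x => L2 _ (rregop_l2 k x).1) : H -> H) \in bounded_linear.
Proof.
rewrite unfold_in; apply/asboolP; split=> [a x y|]; first exact: val_inj.
by exists 1 => x; rewrite mul1r; exact: (rregop_l2 k x).2.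
Qed.

Definition rregop (k : G) : B := Bop _ (rregop_subproof k).

Lemma rregop_basis k h : rregop k (basis h) = basis (h * k)%g.
Proof.
apply/val_inj/funext => j /=; congr (nat_of_bool _)%:R.
by rewrite -(inj_eq (mulIg k)) mulgVK.
Qed.

Lemma l2norm_rregop k x : l2norm (rregop k x) <= l2norm x.
Proof. exact: (rregop_l2 k x).2. Qed.

Lemma adjoint_rregop k : adjoint_of (rregop k : B) (rregop k^-1%g).
Proof.
by apply: adjoint_of_basisP => y i; rewrite rregop_basis inner_basis/= invgK.
Qed.

Lemma inner_rregop k x y : inner (rregop k x) (rregop k y) = inner x y.
Proof.
rewrite adjoint_rregop; congr inner; apply/val_inj/funext => j /=.
by rewrite invgK mulgK.
Qed.

Lemma adjoint_regop g : adjoint_of (regop g : B) (regop g^-1%g).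
Proof.
by apply: adjoint_of_basisP => y i; rewrite regop_basis inner_basis/= invgK.
Qed.

Lemma regop_rregop g k : (regop g : B) * rregop k = rregop k * regop g.
Proof.
by apply/val_inj/funext => x; apply/val_inj/funext => j /=; rewrite mulgA.
Qed.

Lemma regop1 : regop 1%g = 1 :> B.
Proof.
apply/val_inj/funext => x; apply/val_inj/funext => j /=.
by rewrite invg1 mul1g.
Qed.

Lemma regopM g h : regop (g * h)%g = regop g * regop h :> B.
Proof.
apply/val_inj/funext => x; apply/val_inj/funext => j /=.
by rewrite invgM mulgA.
Qed.

(** The vectors [rregop k^-1 (X (rregop k x))] are bounded by
    [opnorm X * l2norm x], so that they converge weakly along [w]. *)
Lemma limit_compression_exists w : exists psi : B -> B, forall X x y,
  (fun k => inner (X (rregop k x)) (rregop k y)) @ ultra w --> inner (psi X x) y.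
Proof.
have bound X x k : l2norm (rregop k^-1%g (X (rregop k x))) <= opnorm X * l2norm x.
  apply: le_trans (l2norm_rregop _ _) _; apply: le_trans (l2norm_bop _ _) _.
  by rewrite ler_wpM2l ?opnorm_ge0// l2norm_rregop.
have lim X x := ultra_weak_limit w (bound X x).
have [p pP] := choice (fun Xx : B * H => lim Xx.1 Xx.2).
have pcvg X x y : (fun k => inner (X (rregop k x)) (rregop k y)) @ ultra w -->
    inner (p (X, x)) y.
  have -> : (fun k => inner (X (rregop k x)) (rregop k y)) =
      (fun k => inner (rregop k^-1%g (X (rregop k x))) y).
    by apply/funext => k; rewrite adjoint_rregop invgK.
  exact: (pP (X, x)).2.
have pB X : (fun x => p (X, x)) \in bounded_linear.
  rewrite unfold_in; apply/asboolP; split=> [a x y|].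
    apply: l2_ext => z; apply: (cvgC_unique (pcvg X (a *: x + y) z)).
    have -> : (fun k => inner (X (rregop k (a *: x + y))) (rregop k z)) =
      (fun k => a * inner (X (rregop k x)) (rregop k z) +
                inner (X (rregop k y)) (rregop k z)).
      by apply/funext => k; rewrite !linearP innerP.
    rewrite innerP; apply: cvgD; last exact: pcvg.
    by apply: cvgMr; exact: pcvg.
  by exists (opnorm X) => x; exact: (pP (X, x)).1.
by exists (fun X => Bop _ (pB X)).
Qed.

(** The operator [rregop k^-1] is the adjoint of [rregop k], so this is the limit
    of [rregop k^-1 * X * rregop k] along [w] in the weak operator topology. *)
Definition limit_compression w : B -> B := sval (cid (limit_compression_exists w)).

Lemma limit_compression_cvg w X x y :
  (fun k => inner (X (rregop k x)) (rregop k y)) @ ultra w -->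
  inner (limit_compression w X x) y.
Proof. by rewrite /limit_compression; case: cid => psi /= psiP; exact: psiP. Qed.

Lemma limit_compressionE w X Y : (forall x y,
    (fun k => inner (X (rregop k x)) (rregop k y)) @ ultra w --> inner (Y x) y) ->
  limit_compression w X = Y.
Proof.
move=> XY; apply/val_inj/funext => x; apply: l2_ext => y.
exact: (cvgC_unique (@limit_compression_cvg w X x y) (XY x y)).
Qed.

Lemma limit_compression_linear w : linear (limit_compression w).
Proof.
move=> a X Y; apply: limit_compressionE => x y.
have -> : (fun k => inner ((a *: X + Y) (rregop k x)) (rregop k y)) =
    (fun k => a * inner (X (rregop k x)) (rregop k y) +
              inner (Y (rregop k x)) (rregop k y)).
  by apply/funext => k; exact: innerP.
rewrite /= innerP; apply: cvgD; last exact: limit_compression_cvg.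
by apply: cvgMr; exact: limit_compression_cvg.
Qed.

Lemma limit_compression_cp w : completely_positive (limit_compression w).
Proof.
split=> [|n X X0 xi]; first exact: limit_compression_linear.
apply: (@cvgC_ge0 _ _ (ultra w) _ (fun k => \sum_(i < n) \sum_(j < n)
  inner (X i j (rregop k (xi j))) (rregop k (xi i)))).
  by move=> k; exact: (X0 (fun i => rregop k (xi i))).
apply: cvgC_sum => i; apply: cvgC_sum => j; rewrite mxE.
exact: limit_compression_cvg.
Qed.

Lemma limit_compression_norm_le w X : opnorm (limit_compression w X) <= opnorm X.
Proof.
apply: opnorm_le_inner => [|x y]; first exact: opnorm_ge0.
apply: (cvgC_le_norm _ (@limit_compression_cvg w X x y)) => k.
apply: le_trans (inner_bop_le _ _ _) _; rewrite lecR.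
by rewrite !ler_pM ?mulr_ge0 ?l2norm_ge0 ?opnorm_ge0 ?l2norm_rregop.
Qed.

(** On the commutant of the right translations the compressions are constant. *)
Lemma limit_compression_id w T :
  (forall k, T * rregop k = rregop k * T) -> limit_compression w T = T.
Proof.
move=> TR; apply: limit_compressionE => x y.
have -> : (fun k => inner (T (rregop k x)) (rregop k y)) = (fun=> inner (T x) y).
  apply/funext => k; rewrite -(inner_rregop k (T x)).
  by have := congr1 (fun S : B => S x) (TR k) => /= ->.
exact: cvg_cst.
Qed.

Lemma limit_compression1 w : limit_compression w 1 = 1.
Proof. by apply: limit_compression_id => k; rewrite mul1r mulr1. Qed.

Lemma limit_compression_regop w g : limit_compression w (regop g) = regop g.
Proof. by apply: limit_compression_id => k; exact: regop_rregop. Qed.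

(** Left translations commute with right ones, so they go through every
    compression. *)
Lemma limit_compression_regopJ w X g h :
  limit_compression w (regop g * X * regop h) =
  regop g * limit_compression w X * regop h.
Proof.
apply: limit_compressionE => x y.
have -> : (fun k => inner ((regop g * X * regop h) (rregop k x)) (rregop k y)) =
  (fun k => inner (X (rregop k (regop h x))) (rregop k (regop g^-1%g y))).
  apply/funext => k.
  have c l z : regop l (rregop k z) = rregop k (regop l z) :> H.
    exact: (congr1 (fun S : B => S z) (regop_rregop l k)).
  rewrite -[LHS]/(inner (regop g (X (regop h (rregop k x)))) (rregop k y)).
  by rewrite adjoint_regop !c.
rewrite [X in _ --> X]adjoint_regop; exact: limit_compression_cvg.
Qed.

Lemma limit_compression_entry w X g h :
  inner (limit_compression w X (basis h)) (basis g) =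
  pure_state w (E0 (regop g^-1%g * X * regop h)).
Proof.
apply: (cvgC_unique (@limit_compression_cvg w X (basis h) (basis g))).
have [c cP] := linfP (E0 (regop g^-1%g * X * regop h)).
rewrite /pure_state; have := @beta_ext_cvg _ _ w _ c cP.
have -> // : linfval (E0 (regop g^-1%g * X * regop h)) =
  (fun k => inner (X (rregop k (basis h))) (rregop k (basis g))).
apply/funext => k.
rewrite -[LHS]/(inner (regop g^-1%g (X (regop h (basis k)))) (basis k)).
by rewrite !rregop_basis regop_basis adjoint_regop invgK regop_basis.
Qed.

Lemma limit_compression_mulop w f :
  limit_compression w (mulop f) = mulop (pi_omega w f).
Proof.
apply: bop_ext_basis => g h.
apply: (cvgC_unique (@limit_compression_cvg w (mulop f) (basis h) (basis g))).
have -> : (fun k => inner (mulop f (rregop k (basis h))) (rregop k (basis g))) =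
  (fun k => f (g * k)%g * (g == h)%:R).
  apply/funext => k; rewrite !rregop_basis inner_basis/=.
  by rewrite (inj_eq (mulIg k)).
rewrite inner_basis /=; apply: cvgMl.
have [c fc] := linfP f.
exact: (@beta_ext_cvg _ _ w (fun k => f (g * k)%g) c (fun k => fc _)).
Qed.

(** The limit of compressions is the regular extension: the matrix entries
    agree, and they determine an operator. *)
Lemma regular_extensionE w : regular_extension R w = limit_compression w.
Proof.
have ex : is_regular_extension w (limit_compression w : B -> B).
  by split; [exact: limit_compression_cp|exact: limit_compression_entry].
have [_ entry] := getPex (ex_intro _ _ ex).
apply/funext => X; apply: bop_ext_basis => g h.
by rewrite limit_compression_entry; exact: entry.
Qed.

End Translations.

(** * The homomorphism on the crossed product *)

Section CrossedProduct.
Context {R : realType} {G : groupType}.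
Local Notation C := R[i].
Local Notation H := (l2 R G).
Local Notation B := (bop R G).
Implicit Types (x y z : H) (S T X Y : B) (w : beta G) (f : linfty R G).

Lemma linfty_mul_subproof f1 f2 : exists c : R, forall t, normc (f1 t * f2 t) <= c.
Proof.
have [c1 f1c] := linfP f1; have [c2 f2c] := linfP f2.
exists (c1 * c2) => t; rewrite ComplexField.Normc.normcM.
by apply: ler_pM; rewrite ?normc_ge0.
Qed.

Definition linfty_mul f1 f2 : linfty R G := Linfty _ (linfty_mul_subproof f1 f2).

Lemma linfty_conj_subproof f : exists c : R, forall t, normc ((f t)^*) <= c.
Proof.
have [c fc] := linfP f; exists c => t; apply: le_trans (fc t).
by rewrite -lecR -!normCE norm_conjC.
Qed.

Definition linfty_conj f : linfty R G := Linfty _ (linfty_conj_subproof f).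

Lemma linfty_cst_subproof (a : C) : exists c : R, forall t : G, normc a <= c.
Proof. by exists (normc a). Qed.

Definition linfty_cst (a : C) : linfty R G := Linfty _ (linfty_cst_subproof a).

Lemma mulopM f1 f2 : mulop f1 * mulop f2 = mulop (linfty_mul f1 f2).
Proof.
by apply/val_inj/funext => x; apply/val_inj/funext => k /=; rewrite mulrA.
Qed.

Lemma adjoint_mulop f : adjoint_of (mulop f : B) (mulop (linfty_conj f)).
Proof.
apply: adjoint_of_basisP => y i.
have -> : mulop f (basis i) = f i *: basis i.
  apply/val_inj/funext => k.
  rewrite -[LHS]/(f k * (k == i)%:R) -[RHS]/(f i * (k == i)%:R).
  by case: (eqVneq k i) => [->//|_]; rewrite !mulr0.
by rewrite innerZr inner_basis.
Qed.

(** Limits along an ultrafilter are multiplicative on bounded functions. *)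
Lemma pi_omega_mul w f1 f2 g :
  pi_omega w (linfty_mul f1 f2) g = pi_omega w f1 g * pi_omega w f2 g.
Proof.
have [c1 f1c] := linfP f1; have [c2 f2c] := linfP f2.
have [c fc] := linfP (linfty_mul f1 f2).
apply: (cvgC_unique (@beta_ext_cvg _ _ (beta_act g w) _ c fc)).
apply: cvgM; [exact: (@beta_ext_cvg _ _ (beta_act g w) _ c1 f1c)|].
exact: (@beta_ext_cvg _ _ (beta_act g w) _ c2 f2c).
Qed.

Lemma pi_omega_cst w (a : C) g : pi_omega w (linfty_cst a) g = a.
Proof.
apply: (cvgC_unique (@beta_ext_cvg _ _ (beta_act g w) (fun=> a) (normc a) (fun=> lexx _))).
exact: cvg_cst.
Qed.

Lemma limit_compression_mulopM w f1 f2 :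
  limit_compression w (mulop f1 * mulop f2) =
  limit_compression w (mulop f1) * limit_compression w (mulop f2).
Proof.
rewrite mulopM !limit_compression_mulop mulopM.
apply/val_inj/funext => x; apply/val_inj/funext => k /=.
by congr (_ * _); exact: pi_omega_mul.
Qed.

(** The Lipschitz estimate is only asked between a point and a zero of [g]; for an
    additive [g] it reduces to a bound on [g (u - v)]. *)
Lemma closed_lipschitz_kernel (V W : normedModType C) (g : V -> W) (K : C) :
  0 <= K -> (forall u v, g v = 0 -> `|g u| <= K * `|u - v|) ->
  closed [set u | g u = 0].
Proof.
move=> K0 gK u clu; apply/eqP; rewrite -normr_eq0; apply: contrapT => /negP gu.
have gup : 0 < `|g u| by rewrite lt_def gu normr_ge0.
have K1 : 0 < K + 1 by rewrite ltr_wpDl.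
have [v [/= gv uv]] := clu _ (nbhsx_ballx u _ (divr_gt0 gup K1)).
rewrite -ball_normE /= in uv.
suff h : K * `|u - v| < `|g u| by move: (le_lt_trans (gK u v gv) h); rewrite ltxx.
apply: (@le_lt_trans _ _ (K * (`|g u| / (K + 1)))).
  by rewrite ler_wpM2l// ltW.
by rewrite mulrA ltr_pdivrMr// mulrC ltr_pM2l// ltrDl.
Qed.

(** Choi's multiplicative domain, by the two-sided property rather than by
    [Phi (S^* S) = Phi S^* Phi S] and its mirror image: in this form it is
    visibly an algebra. *)
Definition multiplicative_domain (Phi : B -> B) : set B :=
  [set S | forall Y, Phi (S * Y) = Phi S * Phi Y /\ Phi (Y * S) = Phi Y * Phi S].

Lemma normM_le S T : `|S * T| <= `|S| * `|T|.
Proof. by rewrite -[X in _ <= X]rmorphM/= lecR opnormM. Qed.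

Lemma bop_scalel (a : C) S T : (a *: S) * T = a *: (S * T).
Proof. exact: val_inj. Qed.

Lemma bop_scaler (a : C) S T : S * (a *: T) = a *: (S * T).
Proof. by apply/val_inj/funext => x /=; exact: linearZ. Qed.

(** Taking adjoints exchanges the two defining identities, which gives stability
    under adjoints; each identity is a closed condition for a contraction. *)
Lemma multiplicative_domain_cstar (Phi : B -> B) :
  completely_positive Phi -> Phi 1 = 1 -> (forall T, `|Phi T| <= `|T|) ->
  cstar_subalgebra (multiplicative_domain Phi).
Proof.
move=> cp Phi1 PhiN; have Phil := cp.1; split.
  split.
  - by move=> Y; rewrite Phi1 !mul1r !mulr1.
  - move=> a S T SM TM Y; have [SY YS] := SM Y; have [TY YT] := TM Y; split.
      by rewrite mulrDl bop_scalel !Phil SY TY mulrDl bop_scalel.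
    by rewrite mulrDr bop_scaler !Phil YS YT mulrDr bop_scaler.
  - move=> S T SM TM Y; split.
      by rewrite -mulrA (SM _).1 (TM _).1 (SM T).1 mulrA.
    by rewrite mulrA (TM _).2 (SM _).2 (TM S).2 -mulrA.
  - move=> S T SM ST Y; have [Y' YY'] := adjoint_exists Y; split.
      apply: (@adjoint_of_inj _ _ (Phi (Y' * S))).
        by apply: cp_adjoint => //; apply: adjoint_ofM => //; exact: adjoint_ofC.
      rewrite (SM Y').2; apply: adjoint_ofM; last exact: cp_adjoint.
      by apply: cp_adjoint => //; exact: adjoint_ofC.
    apply: (@adjoint_of_inj _ _ (Phi (S * Y'))).
      by apply: cp_adjoint => //; apply: adjoint_ofM => //; exact: adjoint_ofC.
    rewrite (SM Y').1; apply: adjoint_ofM; first exact: cp_adjoint.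
    by apply: cp_adjoint => //; exact: adjoint_ofC.
have PhiB S T : Phi (S - T) = Phi S - Phi T.
  by rewrite addrC -scaleN1r Phil scaleN1r addrC.
have -> : multiplicative_domain Phi =
    \bigcap_(Y in setT) ([set S | Phi (S * Y) - Phi S * Phi Y = 0] `&`
                         [set S | Phi (Y * S) - Phi Y * Phi S = 0]).
  apply/seteqP; split=> [S SM Y _|S SM Y]; last first.
    by have [/subr0_eq -> /subr0_eq ->] := SM Y I.
  by have [h1 h2] := SM Y; split=> /=; rewrite ?h1 ?h2 subrr.
apply: closed_bigI => Y _; apply: closedI.
  apply: (@closed_lipschitz_kernel _ _ _ (`|Y| + `|Y|)).
    by rewrite addr_ge0.
  move=> S T /subr0_eq hT.
  have -> : Phi (S * Y) - Phi S * Phi Y = Phi ((S - T) * Y) - Phi (S - T) * Phi Y.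
    by rewrite mulrBl !PhiB mulrBl hT opprB addrA subrK.
  rewrite [leRHS]mulrDl; apply: le_trans (ler_normB _ _) _; apply: lerD.
    by apply: le_trans (PhiN _) _; rewrite mulrC normM_le.
  by apply: le_trans (normM_le _ _) _; rewrite mulrC ler_pM.
apply: (@closed_lipschitz_kernel _ _ _ (`|Y| + `|Y|)).
  by rewrite addr_ge0.
move=> S T /subr0_eq hT.
have -> : Phi (Y * S) - Phi Y * Phi S = Phi (Y * (S - T)) - Phi Y * Phi (S - T).
  by rewrite mulrBr !PhiB mulrBr hT opprB addrA subrK.
rewrite [leRHS]mulrDl; apply: le_trans (ler_normB _ _) _; apply: lerD.
  by apply: le_trans (PhiN _) _; rewrite normM_le.
by apply: le_trans (normM_le _ _) _; rewrite ler_pM.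
Qed.

Lemma limit_compression_normr_le w T : `|limit_compression w T| <= `|T|.
Proof. by rewrite lecR limit_compression_norm_le. Qed.

(** The generators are in the multiplicative domain: the diagonal operators by
    Choi's criterion, the translations because compression commutes with them. *)
Lemma crossed_product_multiplicative w S T : crossed_product R G S ->
  limit_compression w (S * T) = limit_compression w S * limit_compression w T.
Proof.
have cp := @limit_compression_cp R G w; have Phi1 := @limit_compression1 R _ w.
suff sub : crossed_product R G `<=` multiplicative_domain (limit_compression w).
  by move=> /sub/(_ T)[].
apply: smallest_sub.
  exact: multiplicative_domain_cstar (@limit_compression_normr_le w).
move=> _ [[f _ <-]|[g _ <-]] Y.
  split.
    apply: (choi_left Y cp Phi1 (adjoint_ofC (adjoint_mulop f))).
    exact: limit_compression_mulopM.
  apply: (choi_right _ cp Phi1 (adjoint_mulop f)).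
  exact: limit_compression_mulopM.
have := limit_compression_regopJ w Y g 1%g.
have := limit_compression_regopJ w Y 1%g g.
by rewrite regop1 !mul1r !mulr1 limit_compression_regop => -> ->.
Qed.

Lemma limit_compression_term w f g :
  limit_compression w (mulop f * regop g) = mulop (pi_omega w f) * regop g.
Proof.
have := limit_compression_regopJ w (mulop f) 1%g g.
by rewrite regop1 !mul1r limit_compression_mulop.
Qed.

Lemma limit_compression_pi_lambda w :
  is_pi_lambda w (limit_compression w : B -> B).
Proof.
split.
  split=> [a S T _ _|S T SC _|S T _].
  - exact: limit_compression_linear.
  - exact: crossed_product_multiplicative.
  - by apply: cp_adjoint; exact: limit_compression_cp.
move=> f g T.
have -> : series (fun n => mulop (pi_omega w (f n)) * regop (g n)) =
    limit_compression w \o series (fun n => mulop (f n) * regop (g n)).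
  apply/funext => n /=; rewrite /series /=.
  have Phil := @limit_compression_linear R _ w.
  elim: n => [|n IH].
    rewrite !big_geq//; apply/esym/limit_compression_id => k.
    by rewrite mul0r mulr0.
  rewrite !big_nat_recr//= IH -limit_compression_term.
  by rewrite addrC -[X in X + _]scale1r -Phil scale1r addrC.
apply: (@cvg_lipschitz _ _ _ _ _ _ _ _ _ _ 1) => // n.
have Phil := @limit_compression_linear R _ w.
rewrite mul1r /= addrC -scaleN1r -Phil scaleN1r addrC.
exact: limit_compression_normr_le.
Qed.

Lemma crossed_product_mulop f : crossed_product R G (mulop f).
Proof. by apply: sub_gen_smallest; left; exists f. Qed.

Lemma crossed_product_regop g : crossed_product R G (regop g).
Proof. by apply: sub_gen_smallest; right; exists g. Qed.

(** A single term [M_f U_g] is a series with one nonzero term, on which the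
    defining property prescribes the value. *)
Lemma pi_lambda_term w f g :
  pi_lambda R w (mulop f * regop g) = mulop (pi_omega w f) * regop g.
Proof.
have [_ ser] := getPex (ex_intro _ _ (limit_compression_pi_lambda w)).
rewrite -/(pi_lambda R w) in ser.
pose F n := if n is 0%N then f else linfty_cst 0.
have cst0 (h : linfty R G) : (forall k, h k = 0) -> mulop h = 0 :> B.
  move=> h0; apply/val_inj/funext => x; apply/val_inj/funext => k /=.
  by rewrite h0 mul0r.
have one (u : nat -> B) : (forall n, u n.+1 = 0) -> series u @ \oo --> u 0%N.
  move=> u0; rewrite -cvg_shiftS.
  have -> : [sequence series u n.+1]_n = (fun=> u 0%N); last exact: cvg_cst.
  by apply/funext => n; rewrite /series /= big_nat_recl// big1 ?addr0.
have /ser h : series (fun n => mulop (F n) * regop g) @ \oo -->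
    (mulop f * regop g : B).
  by apply: one => n; rewrite cst0// mul0r.
have h' : series (fun n => mulop (pi_omega w (F n)) * regop g) @ \oo -->
    (mulop (pi_omega w f) * regop g : B).
  by apply: one => n; rewrite cst0 ?mul0r// => k; exact: pi_omega_cst.
by apply: (cvg_unique _ h h'); exact: norm_hausdorff.
Qed.

Lemma mulop1 : mulop (linfty_cst 1) = 1 :> B.
Proof.
by apply/val_inj/funext => x; apply/val_inj/funext => k /=; rewrite mul1r.
Qed.

Lemma image_algebra_mulop w f : image_algebra R w (mulop (pi_omega w f)).
Proof.
exists (mulop f); first exact: crossed_product_mulop.
by have := pi_lambda_term w f 1%g; rewrite regop1 !mulr1.
Qed.

Lemma image_algebra_regop w g : image_algebra R w (regop g).
Proof.
exists (regop g); first exact: crossed_product_regop.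
have := pi_lambda_term w (linfty_cst 1) g.
have -> : mulop (pi_omega w (linfty_cst 1)) = mulop (linfty_cst 1) :> B.
  apply/val_inj/funext => x; apply/val_inj/funext => k /=.
  by congr (_ * _); exact: pi_omega_cst.
by rewrite mulop1 !mul1r.
Qed.

End CrossedProduct.

(** * The group von Neumann algebra and rigidity *)

Section Rigidity.
Context {R : realType} {G : groupType}.
Local Notation C := R[i].
Local Notation H := (l2 R G).
Local Notation B := (bop R G).
Implicit Types (x y z : H) (S T X Y : B) (w : beta G) (f : linfty R G).

Definition translation_commutant : set B :=
  [set T | forall k, T * rregop k = rregop k * T].

(** The commutation relations as equations between matrix coefficients, which
    are stable under adjoints and closed in the weak operator topology. *)
Lemma translation_commutantP T : translation_commutant T <->
  forall k x y, inner (T (rregop k x)) y = inner (T x) (rregop k^-1%g y).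
Proof.
split=> [TR k x y|TR k].
  rewrite -adjoint_rregop.
  by have := congr1 (fun S : B => S x) (TR k) => /= ->.
apply/val_inj/funext => x; apply: l2_ext => y.
by rewrite [LHS]TR -adjoint_rregop.
Qed.

Lemma wot_closed_matrix_coefficient_eq (p q : H * H) :
  wot_closed [set T : B | inner (T p.1) p.2 = inner (T q.1) q.2].
Proof.
pose W := initial_topology (@matrix_coefficients R G).
have ev (r : H * H) : continuous ((fun T => inner (T r.1) r.2) : W -> C).
  move=> T.
  apply: (@continuous_comp W {ptws H * H -> C} C (@matrix_coefficients R G) (fun m => m r)).
    exact: initial_continuous.
  exact: (@proj_continuous _ (fun=> C) r).
have -> : [set T : B | inner (T p.1) p.2 = inner (T q.1) q.2] =
    ((fun T : W => inner (T p.1) p.2 - inner (T q.1) q.2) @^-1` [set 0] : set W).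
  by apply/seteqP; split=> T /= => [->|/subr0_eq//]; rewrite subrr.
rewrite /wot_closed; apply: (@closed_comp W C).
  by move=> T _; exact: cvgB (ev p T) (ev q T).
exact: (accessible_closed_set1 (hausdorff_accessible (@norm_hausdorff _ C))).
Qed.

Lemma translation_commutant_vna : von_neumann_algebra translation_commutant.
Proof.
split.
  split.
  - by move=> k; rewrite mul1r mulr1.
  - move=> a S T SR TR k.
    by rewrite mulrDl mulrDr bop_scalel bop_scaler SR TR.
  - by move=> S T SR TR k; rewrite -mulrA TR mulrA SR mulrA.
  - move=> S T /translation_commutantP SR ST; apply/translation_commutantP.
    move=> k x y; rewrite -(inner_conj y) -ST -[k in rregop k x]invgK -SR.
    by rewrite ST inner_conj.
have -> : translation_commutant = \bigcap_(q in [set: G * (H * H)])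
    [set T : B | inner (T (rregop q.1 q.2.1, q.2.2).1) (rregop q.1 q.2.1, q.2.2).2
      = inner (T (q.2.1, rregop q.1^-1%g q.2.2).1) (q.2.1, rregop q.1^-1%g q.2.2).2].
  apply/seteqP; split=> [T /translation_commutantP TR [k [x y]] _|T TR].
    exact: TR.
  by apply/translation_commutantP => k x y; exact: (TR (k, (x, y)) I).
rewrite /wot_closed; apply: closed_bigI => q _.
exact: wot_closed_matrix_coefficient_eq.
Qed.

(** The group von Neumann algebra commutes with the right translations, and
    compressing by them leaves its elements unchanged. *)
Lemma limit_compression_group_vna w T :
  group_vna R G T -> limit_compression w T = T.
Proof.
move=> GT; apply: limit_compression_id.
suff : group_vna R G `<=` translation_commutant by apply.
apply: smallest_sub; first exact: translation_commutant_vna.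
by move=> _ [g _ <-] k; exact: regop_rregop.
Qed.

Lemma positive_1mx T : positive T <-> positive_mx (const_mx T : 'M[B]_1).
Proof.
split=> [T0 xi|T0 x].
  by rewrite !big_ord1 mxE; exact: T0.
by have := T0 (fun=> x); rewrite !big_ord1 mxE.
Qed.

Lemma cp_positive (Phi : B -> B) T :
  completely_positive Phi -> positive T -> positive (Phi T).
Proof.
move=> [_ cp] /positive_1mx/cp; rewrite map_const_mx.
by move=> /positive_1mx.
Qed.

Lemma vector_state (Phi : B -> B) :
  linear Phi -> (forall T, positive T -> positive (Phi T)) -> Phi 1 = 1 ->
  state (fun X => inner (Phi X (basis 1%g)) (basis 1%g)).
Proof.
move=> Phil Phip Phi1; split=> [a X Y|T T0|].
- by rewrite Phil; exact: innerP.
- exact: Phip.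
- by rewrite Phi1 inner_basis /= eqxx.
Qed.

Lemma inner_basis_translate T g h :
  inner (T (basis h)) (basis g) =
  inner ((regop g^-1%g * T * regop h) (basis 1%g)) (basis 1%g).
Proof.
rewrite -[RHS]/(inner (regop g^-1%g (T (regop h (basis 1%g)))) (basis 1%g)).
by rewrite adjoint_regop invgK !regop_basis !mulg1.
Qed.

Lemma pi_omega1 w f : pi_omega w f 1%g = pure_state w f.
Proof.
rewrite /pure_state /= /beta_ext /beta_act /=.
by have -> : (fun k : G => 1 * k)%g = id by apply/funext => k; rewrite mul1g.
Qed.

End Rigidity.

Theorem corollary9 (R : realType) (G : groupType)
    (hG : countable [set: G]) (w : beta G)
    (huniq : exists! phi : bop R G -> R[i],
       state phi /\ forall f : linfty R G, phi (mulop f) = pure_state w f) :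
  group_vna R G `<=` range (regular_extension R w) /\
  range (regular_extension R w) `<=` fixed_by_cp (image_algebra R w).
Proof.
rewrite regular_extensionE; split.
  by move=> T GT; exists T => //; exact: limit_compression_group_vna.
move=> _ [X _ <-] Phi cpPhi PhiA.
pose psi := limit_compression w : bop R G -> bop R G.
have Phi1 : Phi 1 = 1 by rewrite -regop1; apply: PhiA; exact: image_algebra_regop.
have PhiU g : Phi (regop g) = regop g by apply: PhiA; exact: image_algebra_regop.
have PhiJ g h Y : Phi (regop g * Y * regop h) = regop g * Phi Y * regop h.
  have adjU k := @adjoint_regop R G k.
  have UU k : Phi (regop k^-1%g * regop k) = Phi (regop k^-1%g) * Phi (regop k).
    by rewrite -regopM !PhiU -regopM.
  rewrite (choi_right _ cpPhi Phi1 (adjU h) (UU h)) PhiU.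
  have := choi_left Y cpPhi Phi1 (adjU g^-1%g) (UU g^-1%g).
  by rewrite invgK PhiU => ->.
have psil := @limit_compression_linear R G w.
have psicp := @limit_compression_cp R G w.
have psi1 := @limit_compression1 R G w.
have psi_entry f : inner (psi (mulop f) (basis 1%g)) (basis 1%g) = pure_state w f.
  rewrite /psi limit_compression_mulop inner_basis.
  rewrite -[LHS]/(pi_omega w f 1%g * (1%g == 1%g :> G)%:R).
  by rewrite eqxx mulr1 pi_omega1.
have [phi0 [_ phi0U]] := huniq.
have agree Y : inner (Phi (psi Y) (basis 1%g)) (basis 1%g) =
               inner (psi Y (basis 1%g)) (basis 1%g).
  transitivity (phi0 Y); last first.
    rewrite (phi0U (fun Y => inner (psi Y (basis 1%g)) (basis 1%g)))//; split=> //.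
    by apply: vector_state => // T; exact: cp_positive.
  apply/esym; rewrite (phi0U (fun Y => inner (Phi (psi Y)  (basis 1%g)) (basis 1%g)))//.
  split=> [|f].
    apply: (@vector_state _ _ (Phi \o psi)) => [a S T|T T0|] /=.
    - by rewrite /psi psil (cpPhi.1).
    - by apply: cp_positive => //; exact: cp_positive.
    - by rewrite [psi 1]psi1.
  rewrite -psi_entry; congr (inner (bopval _ _) _); apply: PhiA.
  by rewrite /psi limit_compression_mulop; exact: image_algebra_mulop.
apply: bop_ext_basis => g h.
rewrite [LHS]inner_basis_translate [RHS]inner_basis_translate.
by rewrite -PhiJ -limit_compression_regopJ; exact: agree.
Qed.
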